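(* Let $E\subset\mathbb{P}^2_{\mathbb{C}}$ be an irreducible nodal cubic curve (i.e. an irreducible plane cubic whose only singularity is one node). Then $E$ has exactly three sextactic points, hence exactly three hyperosculating conics $Q_1,Q_2,Q_3$, and: (a) for each $i$, the arrangement $E\cup Q_i$ (degree $5$) is free with exponents $(2,2)$; (b) for each $i\neq j$, the arrangement $E\cup Q_i\cup Q_j$ (degree $7$) is free with exponents $(3,3)$; (c) the arrangement $E\cup Q_1\cup Q_2\cup Q_3$ (degree $9$) is a $4$-syzygy curve with exponents $(5,5,5,5)$. *)

(* Defs.v *)
From HB Require Import structures.
From mathcomp Require Import all_boot all_order all_algebra.
From mathcomp Require Import reals.
From mathcomp Require Import complex.
From mathcomp Require Import mpoly.

Set Implicit Arguments.
Unset Strict Implicit.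
Unset Printing Implicit Defensive.

Import Order.TTheory GRing.Theory Num.Theory.
Local Open Scope ring_scope.

Section PlaneCurves.
Variable C : closedFieldType.

Notation S := {mpoly C[3]}.

Definition nonzero_pt (p : 'I_3 -> C) : Prop := exists i, p i != 0.
Definition same_pt (p q : 'I_3 -> C) : Prop :=
  exists c : C, c != 0 /\ forall i, q i = c * p i.

Definition on_curve (F : S) (p : 'I_3 -> C) : Prop := F.@[p] = 0.

Definition singular_pt (F : S) (p : 'I_3 -> C) : Prop :=
  nonzero_pt p /\ on_curve F p /\ forall i : 'I_3, (F^`M(i)).@[p] = 0.

Definition smooth_pt (F : S) (p : 'I_3 -> C) : Prop :=
  nonzero_pt p /\ on_curve F p /\ exists i : 'I_3, (F^`M(i)).@[p] != 0.

Definition hessian_at (F : S) (p : 'I_3 -> C) : 'M[C]_3 :=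
  \matrix_(i < 3, j < 3) ((F^`M(i))^`M(j)).@[p].

(* A node (ordinary double point, A1 singularity) of a plane curve F = 0:
   a singular point at which the quadratic part of the local equation
   (the tangent cone, given by the Hessian) is a nondegenerate quadratic form
   in the two local coordinates, i.e. the Hessian has rank 2. *)
Definition node_pt (F : S) (p : 'I_3 -> C) : Prop :=
  singular_pt F p /\ \rank (hessian_at F p) = 2%N.

Definition irreducible_mpoly (F : S) : Prop :=
  (0 < mdeg (mlead F))%N /\
  forall G H : S, F = G * H -> (exists c, G = c%:MP) \/ (exists c, H = c%:MP).

Definition irreducible_nodal_cubic (F : S) : Prop :=
  F \is 3.-homog /\ irreducible_mpoly F /\
  exists p, node_pt F p /\ forall q, singular_pt F q -> same_pt p q.

Definition compose (F : S) (gamma : 'I_3 -> {poly C}) : {poly C} :=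
  mmap polyC gamma F.

Definition vanishes_to_order (q : {poly C}) (k : nat) : Prop :=
  forall i, (i < k)%N -> q`_i = 0.

(* Contact order: at a smooth point p of the curve F = 0, the curve G = 0
   meets F = 0 at p with intersection multiplicity >= k iff G vanishes to
   order >= k along (a k-jet of) the local branch of F = 0 through p.
   A k-jet of that branch is an immersed polynomial curve gamma with
   gamma(0) = p along which F vanishes to order >= k. *)
Definition intersection_mult_ge (F G : S) (p : 'I_3 -> C) (k : nat) : Prop :=
  exists gamma : 'I_3 -> {poly C},
    (forall i, (gamma i).[0] = p i) /\
    (~ exists c : C, forall i, (gamma i)^`().[0] = c * p i) /\
    vanishes_to_order (compose F gamma) k /\
    vanishes_to_order (compose G gamma) k.

Definition is_line (L : S) : Prop := L \is 1.-homog /\ L != 0.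
Definition is_conic (Q : S) : Prop := Q \is 2.-homog /\ Q != 0.

Definition flex_pt (F : S) (p : 'I_3 -> C) : Prop :=
  smooth_pt F p /\ exists L, is_line L /\ intersection_mult_ge F L p 3.

Definition hyperosculating_conic (F Q : S) (p : 'I_3 -> C) : Prop :=
  is_conic Q /\ intersection_mult_ge F Q p 6.

Definition sextactic_pt (F : S) (p : 'I_3 -> C) : Prop :=
  smooth_pt F p /\ ~ flex_pt F p /\ exists Q, hyperosculating_conic F Q p.

Definition syzygy (f : S) (rho : 'I_3 -> S) : Prop :=
  \sum_(i < 3) rho i * f^`M(i) = 0.

Definition homog_syzygy (f : S) (r : nat) (rho : 'I_3 -> S) : Prop :=
  syzygy f rho /\ (forall i, rho i \is r.-homog) /\ (exists i, rho i != 0).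

Definition generates_AR (f : S) (m : nat) (rho : 'I_m -> 'I_3 -> S) : Prop :=
  forall a : 'I_3 -> S, syzygy f a ->
    exists g : 'I_m -> S, forall i, a i = \sum_(j < m) g j * rho j i.

Definition free_curve (f : S) (d1 d2 : nat) : Prop :=
  exists rho1 rho2 : 'I_3 -> S,
    homog_syzygy f d1 rho1 /\ homog_syzygy f d2 rho2 /\
    generates_AR f (fun j : 'I_2 => if j == ord0 then rho1 else rho2) /\
    (forall g1 g2 : S, (forall i, g1 * rho1 i + g2 * rho2 i = 0) ->
        g1 = 0 /\ g2 = 0).

Definition msyzygy_curve (f : S) (m : nat) (d : 'I_m -> nat) : Prop :=
  exists rho : 'I_m -> 'I_3 -> S,
    (forall j, homog_syzygy f (d j) (rho j)) /\
    generates_AR f rho /\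
    (forall j0 : 'I_m, ~ exists g : 'I_m -> S,
        forall i, rho j0 i = \sum_(j < m | j != j0) g j * rho j i).

End PlaneCurves.

(* Main.v *)
From HB Require Import structures.
Require Import Defs.
From mathcomp Require Import all_boot all_order all_algebra reals complex mpoly.
From mathcomp Require Import perm boolp ring.

(** Choose coordinates in which the cubic is N = xyz - x^3 - y^3, parametrized by
    t |-> (t, t^2, 1 + t^3).  A form G of degree d has contact of order k with N at the point
    of parameter w iff (t - w)^k divides G(t, t^2, 1 + t^3).  The pullback of a conic is a
    sextic in t whose extreme coefficients agree, so it can be a multiple of (t - w)^6 only if
    w^6 = 1; the flexes are the points with w^3 = -1, so the sextactic points are those with
    w^3 = 1, and each determines its conic up to a scalar.

    The diagonal matrices diag(w^2, w, 1), with w a cube root of unity, preserve N and permute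
    the three conics.  This leaves one arrangement in each of the degrees 5, 7 and 9, whose
    syzygies are found by linear algebra.  Let f be one of these three products.  As f is
    squarefree, the cross product of two of its syzygies is a polynomial multiple of grad f.
    In degrees 5 and 7 the cross product of the two given syzygies is a nonzero constant times
    grad f, and Cramer's rule expresses every syzygy in terms of them.  In degree 9 the four
    given syzygies satisfy two linear relations; pairing these with an arbitrary syzygy gives
    equations over the polynomial ring that are solved with the Koszul complex of x, y, z. *)

Set Implicit Arguments.
Unset Strict Implicit.
Unset Printing Implicit Defensive.

Import Order.TTheory GRing.Theory Num.Theory.
Local Open Scope ring_scope.

(** * Substitution in polynomials *)

(** At a smooth point of N both x and y are nonzero, so t = y / x is a coordinate on the whole curve
    minus its node, and every contact order becomes the multiplicity of a root of one polynomial in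
    t. Divisibility in three variables is treated without factoring. Coprimality is phrased as
    cancellation modulo a polynomial; for each pair of curves an explicit combination of their
    equations is a product of linear forms, which are prime, and it remains to evaluate one equation
    at a point of each line. In degree 7 the model keeps the conics of the two primitive cube roots
    of unity. Their product is a norm, so all three models have integer coefficients, and so have
    their syzygies. The models are also invariant under the exchange of x and y, which organizes the
    syzygies. A cross product of syzygies is checked through one determinant, with rows (x, y, z)
    and the two syzygies: if it is a multiple of f, Euler's formula yields the three components.
    With a constant multiplier this is Saito's criterion for freeness. *)

Definition o0 : 'I_3 := @Ordinal 3 0 isT.
Definition o1 : 'I_3 := @Ordinal 3 1 isT.
Definition o2 : 'I_3 := @Ordinal 3 2 isT.

Lemma I3_ind (P : 'I_3 -> Prop) : P o0 -> P o1 -> P o2 -> forall i, P i.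
Proof.
move=> P0 P1 P2 [[|[|[|//]]] lti].
- by rewrite (_ : Ordinal lti = o0) //; apply: val_inj.
- by rewrite (_ : Ordinal lti = o1) //; apply: val_inj.
- by rewrite (_ : Ordinal lti = o2) //; apply: val_inj.
Qed.

Lemma big_I3 (T : Type) (idx : T) (op : Monoid.law idx) (F : 'I_3 -> T) :
  \big[op/idx]_(i < 3) F i = op (F o0) (op (F o1) (F o2)).
Proof.
rewrite !big_ord_recl big_ord0 Monoid.mulm1.
by congr (op (F _) (op (F _) (F _))); apply: val_inj.
Qed.

Lemma sum_I3 (V : nmodType) (F : 'I_3 -> V) :
  \sum_(i < 3) F i = F o0 + F o1 + F o2.
Proof. by rewrite big_I3 /= addrA. Qed.

Definition vec3 {T : Type} (a b c : T) (i : 'I_3) : T :=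
  match val i with 0%N => a | 1%N => b | _ => c end.

Section Substitution.
Variables (n : nat) (A : comNzRingType).

Lemma mpoly_gen_ind (P : {mpoly A[n]} -> Prop) :
  (forall c, P c%:MP) -> (forall i, P 'X_i) ->
  (forall p q, P p -> P q -> P (p + q)) ->
  (forall p q, P p -> P q -> P (p * q)) -> forall p, P p.
Proof.
move=> PC PX PD PM p; rewrite [p]mpolyE.
apply: (big_ind P) => [||m _]; first by rewrite -[0]mpolyC0.
  exact: PD.
rewrite -mul_mpolyC; apply: (PM) => //; rewrite mpolyXE_id.
apply: (big_ind P) => [||i _]; first by rewrite -[1]mpolyC1.
  exact: PM.
elim: (m i) => [|k IH]; first by rewrite expr0 -[1]mpolyC1.
by rewrite exprS; apply: PM.
Qed.

Lemma mmap_U (T : comNzRingType) (f : {rmorphism A -> T}) (h : 'I_n -> T) i :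
  mmap f h 'X_i = h i.
Proof. by rewrite mmapX mmap1U. Qed.

Lemma rmorph_mmap (T T' : comNzRingType) (f : {rmorphism A -> T})
    (f' : {rmorphism A -> T'}) (g : {rmorphism T -> T'}) (h : 'I_n -> T) :
  (forall c, g (f c) = f' c) ->
  forall p, g (mmap f h p) = mmap f' (fun i => g (h i)) p.
Proof.
move=> gf; elim/mpoly_gen_ind => [c|i|p q IHp IHq|p q IHp IHq].
- by rewrite !mmapC gf.
- by rewrite !mmap_U.
- by rewrite !rmorphD /= IHp IHq.
- by rewrite !rmorphM /= IHp IHq.
Qed.

Lemma mmap_comp (T : comNzRingType) (f : {rmorphism A -> T})
    (h : 'I_n -> T) (u : 'I_n -> {mpoly A[n]}) p :
  mmap f h (mmap (@mpolyC n A) u p) = mmap f (fun i => mmap f h (u i)) p.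
Proof.
exact: (@rmorph_mmap _ _ (@mpolyC n A : {rmorphism _ -> _}) f
          (mmap f h : {rmorphism _ -> _}) u (fun c => mmapC h f c)).
Qed.

(** Substitution is a ring morphism, so it respects congruences modulo [d]. With [d] a power of the
    variable this truncates jets; with [d] a linear form it eliminates a variable. *)
Lemma mmap_congr (T : comNzRingType) (f : {rmorphism A -> T})
    (d : T) (u v : 'I_n -> T) :
  (forall i, exists k, u i - v i = d * k) ->
  forall p, exists k, mmap f u p - mmap f v p = d * k.
Proof.
move=> uv; elim/mpoly_gen_ind => [c|i|p q [k kE] [l lE]|p q [k kE] [l lE]].
- by exists 0; rewrite !mmapC subrr mulr0.
- by rewrite !mmap_U.
- exists (k + l); rewrite !rmorphD /= mulrDr -kE -lE; ring.
- exists (k * mmap f u q + mmap f v p * l).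
  have -> : d * (k * mmap f u q + mmap f v p * l) =
    (d * k) * mmap f u q + mmap f v p * (d * l) by ring.
  rewrite -kE -lE !rmorphM /=; ring.
Qed.

Lemma mmap_homog (T : comNzRingType) (f : {rmorphism A -> T})
    (t : T) (u : 'I_n -> T) d p :
  p \is d.-homog -> mmap f (fun i => t * u i) p = t ^+ d * mmap f u p.
Proof.
move=> /dhomogP hp; rewrite /mmap mulr_sumr; apply: eq_big_seq => m /hp mE.
have {}mE : d = (\sum_(i < n) m i)%N by rewrite -mdegE; exact/esym.
rewrite mulrCA; congr (_ * _); rewrite /mmap1 mE.
under eq_bigr do rewrite exprMn.
by rewrite big_split /= -prodrXr.
Qed.

Lemma mderiv_mmap (u : 'I_n -> {mpoly A[n]}) i p :
  (mmap (@mpolyC n A) u p)^`M(i) =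
  \sum_k mmap (@mpolyC n A) u p^`M(k) * (u k)^`M(i).
Proof.
elim/mpoly_gen_ind: p => [c|j|p q IHp IHq|p q IHp IHq].
- rewrite mmapC mderivC big1 // => k _.
  by rewrite mderivC rmorph0 mul0r.
- rewrite mmap_U (bigD1 j) //= big1 ?addr0 => [|k /negbTE kj].
    rewrite mderivX mnm1E eqxx scale1r (_ : (U_(j) - U_(j))%MM = 0%MM).
      by rewrite mpolyX0 rmorph1 mul1r.
    by apply/mnmP => l; rewrite mnmBE mnm0E subnn.
  by rewrite mderivX mnm1E eq_sym kj scale0r rmorph0 mul0r.
- rewrite rmorphD /= mderivD IHp IHq -big_split; apply: eq_bigr => k _.
  by rewrite /= mderivD rmorphD /= mulrDl.
- rewrite rmorphM /= mderivM IHp IHq mulr_suml mulr_sumr -big_split.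
  apply: eq_bigr => k _; rewrite /= mderivM rmorphD !rmorphM /=; ring.
Qed.

Lemma dhomog_mmap (u : 'I_n -> {mpoly A[n]}) d p :
  (forall i, u i \is 1.-homog) -> p \is d.-homog ->
  mmap (@mpolyC n A) u p \is d.-homog.
Proof.
move=> hu /dhomogP hp; rewrite /mmap big_seq; apply: rpred_sum => m /hp mE.
have {}mE : d = (\sum_(i < n) m i)%N by rewrite -mdegE; exact/esym.
rewrite mul_mpolyC; apply: rpredZ; rewrite /mmap1 mE.
apply: (big_ind2 (fun (p : {mpoly A[n]}) d => p \is d.-homog)) => [||i _].
- exact: dhomog1.
- by move=> p1 d1 p2 d2; apply: dhomogM.
- by have := dhomogMn (m i) (hu i); rewrite mul1n.
Qed.

Lemma euler_homog d (p : {mpoly A[n]}) :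
  p \is d.-homog -> \sum_(i < n) 'X_i * p^`M(i) = d%:R * p.
Proof.
move=> /dhomogP hp; rewrite [p in RHS]mpolyE mulr_sumr.
have derivE i : p^`M(i) = \sum_(m <- msupp p) p@_m *: 'X_[A, m]^`M(i).
  by rewrite {1}[p]mpolyE raddf_sum; apply: eq_bigr => m _; rewrite /= mderivZ.
transitivity (\sum_(i < n) \sum_(m <- msupp p) 'X_i * (p@_m *: 'X_[A, m]^`M(i))).
  by apply: eq_bigr => i _; rewrite derivE mulr_sumr.
rewrite exchange_big; apply: eq_big_seq => m /hp mE /=.
transitivity (\sum_(i < n) (m i)%:R * (p@_m *: 'X_[A, m])); last first.
  have -> : d = (\sum_(i < n) m i)%N by rewrite -mdegE -mE.
  by rewrite -mulr_suml -natr_sum.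
apply: eq_bigr => i _; rewrite mderivX -!scalerAr.
congr (_ *: _); case: (posnP (m i)) => [->|mi]; first by rewrite scale0r mul0r.
rewrite -mpolyXD addmC submK; last by rewrite lep1mP -lt0n.
by rewrite -mul_mpolyC mpolyC_nat.
Qed.

End Substitution.

(** * Linear changes of coordinates *)

Definition actm (K T : comNzRingType) (f : K -> T) (A : 'M[K]_3)
    (u : 'I_3 -> T) (i : 'I_3) : T := \sum_j f (A i j) * u j.

Section ActionOfMatrices.
Variables (K T : comNzRingType) (f : {rmorphism K -> T}).

Lemma actm_mul (A B : 'M[K]_3) u : actm f (A *m B) u = actm f A (actm f B u).
Proof.
apply: funext => i; rewrite /actm.
transitivity (\sum_j \sum_k f (A i k) * f (B k j) * u j).
  apply: eq_bigr => j _; rewrite mxE rmorph_sum mulr_suml.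
  by apply: eq_bigr => k _; rewrite rmorphM.
rewrite exchange_big; apply: eq_bigr => k _; rewrite mulr_sumr.
by apply: eq_bigr => j _; rewrite mulrA.
Qed.

Lemma actm1 u : actm f 1%:M u = u.
Proof.
apply: funext => i; rewrite /actm (bigD1 i) //= big1 => [|j /negbTE ij].
  by rewrite mxE eqxx rmorph1 mul1r addr0.
by rewrite mxE eq_sym ij rmorph0 mul0r.
Qed.

Lemma actmZ (A : 'M[K]_3) c u : actm f A (fun i => c * u i) = fun i => c * actm f A u i.
Proof.
apply: funext => i; rewrite /actm mulr_sumr.
by apply: eq_bigr => j _; rewrite mulrCA.
Qed.

Lemma actm0 (A : 'M[K]_3) : actm f A (fun=> 0) = fun=> 0.
Proof. by apply: funext => i; rewrite /actm big1 // => j _; rewrite mulr0. Qed.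

Lemma rmorph_actm (T' : comNzRingType) (g : {rmorphism T -> T'}) (A : 'M[K]_3) u i :
  g (actm f A u i) = actm (fun c => g (f c)) A (fun j => g (u j)) i.
Proof. by rewrite rmorph_sum; apply: eq_bigr => j _; rewrite rmorphM. Qed.

End ActionOfMatrices.

Section Transport.
Variable C : numClosedFieldType.
Local Notation S := {mpoly C[3]}.
Local Notation actp := (actm (@idfun C)).
Local Notation actS := (actm (@mpolyC 3 C)).
Local Notation Ainv := invmx.

(** This is precomposition with the linear map [A]: a point [p] of [lsub A G] corresponds to the
    point [actp A p] of [G], and matrix products are reversed. *)
Definition lsub (A : 'M[C]_3) (p : S) : S :=
  mmap (@mpolyC 3 C) (actS A (fun j => 'X_j)) p.

HB.instance Definition _ A := GRing.RMorphism.copy (lsub A)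
  (mmap (@mpolyC 3 C) (actS A (fun j => 'X_j))).

Lemma lsubC A c : lsub A c%:MP = c%:MP.
Proof. exact: mmapC. Qed.

Lemma lsubZ A c p : lsub A (c *: p) = c *: lsub A p.
Proof. by rewrite -!mul_mpolyC rmorphM /= lsubC. Qed.

Lemma lsubX A i : lsub A 'X_i = actS A (fun j => 'X_j) i.
Proof. exact: mmap_U. Qed.

Lemma mmap_lsub (T : comNzRingType) (f : {rmorphism C -> T}) h A p :
  mmap f h (lsub A p) = mmap f (actm f A h) p.
Proof.
rewrite /lsub mmap_comp; congr (mmap _ _ _); apply: funext => i.
by rewrite (rmorph_actm _ (mmap f h)) /actm; apply: eq_bigr => j _;
  rewrite /= mmap_U mmapC.
Qed.

Lemma lsub_mul A B p : lsub A (lsub B p) = lsub (B *m A) p.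
Proof. by rewrite {1}/lsub mmap_lsub /lsub actm_mul. Qed.

Lemma lsub1 p : lsub 1%:M p = p.
Proof.
rewrite /lsub actm1 -[RHS]comp_mpoly_id; congr (mmap _ _ _).
by apply: funext => i; rewrite tnth_mktuple.
Qed.

Lemma lsubK A : A \in unitmx -> cancel (lsub A) (lsub (Ainv A)).
Proof. by move=> uA p; rewrite lsub_mul mulmxV // lsub1. Qed.

Lemma lsubVK A : A \in unitmx -> cancel (lsub (Ainv A)) (lsub A).
Proof. by move=> uA p; rewrite lsub_mul mulVmx // lsub1. Qed.

Lemma actpK A : A \in unitmx -> cancel (actp A) (actp (Ainv A)).
Proof. by move=> uA p; rewrite -actm_mul mulVmx // actm1. Qed.

Lemma meval_lsub A p v : (lsub A p).@[v] = p.@[actp A v].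
Proof. exact: mmap_lsub. Qed.

Lemma compose_lsub A p g : compose (lsub A p) g = compose p (actm polyC A g).
Proof. exact: mmap_lsub. Qed.

Lemma dhomog_lsub A d p : p \is d.-homog -> lsub A p \is d.-homog.
Proof.
apply: dhomog_mmap => i; apply: rpred_sum => j _.
by rewrite mul_mpolyC rpredZ // dhomogX /= mdeg1.
Qed.

Lemma mderiv_actS A i j : (actS A (fun j => 'X_j) i)^`M(j) = (A i j)%:MP.
Proof.
rewrite /actm raddf_sum (bigD1 j) //= big1 => [|k /negbTE kj].
  rewrite mderiv_mulC mderivX mnm1E eqxx scale1r addr0.
  rewrite (_ : (U_(j) - U_(j))%MM = 0%MM) ?mpolyX0 ?mulr1 //.
  by apply/mnmP => l; rewrite mnmBE mnm0E subnn.
by rewrite mderiv_mulC mderivX mnm1E kj scale0r mulr0.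
Qed.

Lemma mderiv_lsub A p j :
  (lsub A p)^`M(j) = actS A^T (fun k => lsub A p^`M(k)) j.
Proof.
rewrite /lsub mderiv_mmap; apply: eq_bigr => k _.
by rewrite mderiv_actS mxE mulrC.
Qed.

Lemma actp_neq0 A p : A \in unitmx -> nonzero_pt p -> nonzero_pt (actp A p).
Proof.
move=> uA [i pi]; have [//|h] := pselect (nonzero_pt (actp A p)).
have z : actp A p = fun=> 0.
  apply: funext => j; apply/eqP/negPn/negP => nz; apply: h; by exists j.
by move: pi; rewrite -[p](actpK uA) z actm0 eqxx.
Qed.

Lemma same_pt_act A p q : same_pt p q -> same_pt (actp A p) (actp A q).
Proof.
move=> [c [nz h]]; exists c; split => // i.
by have -> : q = (fun i => c * p i) by [apply: funext]; rewrite actmZ.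
Qed.

Lemma same_pt_actE A p q : A \in unitmx ->
  same_pt (actp A p) (actp A q) <-> same_pt p q.
Proof.
move=> uA; split; last exact: same_pt_act.
by move/(same_pt_act (Ainv A)); rewrite !actpK.
Qed.

Lemma grad_lsub A G p j : ((lsub A G)^`M(j)).@[p] =
  actp A^T (fun k => (G^`M(k)).@[actp A p]) j.
Proof.
rewrite mderiv_lsub (rmorph_actm _ (meval p)) /actm.
by apply: eq_bigr => k _; rewrite /= mevalC meval_lsub.
Qed.

Lemma smooth_lsub A G p : A \in unitmx ->
  smooth_pt (lsub A G) p -> smooth_pt G (actp A p).
Proof.
move=> uA [nz [on sm]]; split; first exact: actp_neq0.
split; first by rewrite /on_curve -meval_lsub.
have [//|h] := pselect (exists i, (G^`M(i)).@[actp A p] != 0).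
have z : (fun k => (G^`M(k)).@[actp A p]) = fun=> 0.
  apply: funext => j; apply/eqP/negPn/negP => nz'; apply: h; by exists j.
case: sm => i.
by rewrite grad_lsub z actm0 eqxx.
Qed.

(** The jet is moved by [A]. It stays immersed: a velocity proportional to the new base point would,
    after applying the inverse of [A], be proportional to the old one. *)
Lemma inter_lsub A G H p k : A \in unitmx ->
  intersection_mult_ge (lsub A G) (lsub A H) p k ->
  intersection_mult_ge G H (actp A p) k.
Proof.
move=> uA [g [g0 [g1 [vG vH]]]]; exists (actm polyC A g).
have horner_act u i : (actm polyC A u i).[0] = actp A (fun i => (u i).[0]) i.
  rewrite /actm horner_sum; apply: eq_bigr => j _.
  by rewrite hornerM hornerC.
split=> [i|]; first by rewrite horner_act; congr (actp A _ i); apply: funext.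
split; last by rewrite -!compose_lsub.
move=> [c hc]; apply: g1; exists c => i.
have E : actp A (fun i => (g i)^`().[0]) = fun i => c * actp A p i.
  apply: funext => j; rewrite -hc /actm raddf_sum horner_sum.
  by apply: eq_bigr => l _; rewrite /= derivM derivC mul0r add0r hornerM hornerC.
have := congr1 (actp (Ainv A)) E; rewrite actpK // actmZ actpK //.
by move/(congr1 (fun u => u i)).
Qed.

Lemma lsub_eq0 A p : A \in unitmx -> (lsub A p == 0) = (p == 0).
Proof. by move=> uA; rewrite -(inj_eq (can_inj (lsubK uA)) p 0) rmorph0. Qed.

Lemma inter_lsubV A G H p k : A \in unitmx ->
  intersection_mult_ge (lsub A G) H p k ->
  intersection_mult_ge G (lsub (Ainv A) H) (actp A p) k.
Proof. by move=> uA h; apply: inter_lsub => //; rewrite lsubVK. Qed.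

Lemma flex_lsub A G p : A \in unitmx ->
  flex_pt (lsub A G) p -> flex_pt G (actp A p).
Proof.
move=> uA [sm [L [[hL nL] iL]]]; split; first exact: smooth_lsub.
exists (lsub (Ainv A) L); split; last exact: inter_lsubV.
by split; [exact: dhomog_lsub | rewrite lsub_eq0 // unitmx_inv].
Qed.

Lemma hyperosc_lsub A G Q p : A \in unitmx ->
  hyperosculating_conic (lsub A G) Q p ->
  hyperosculating_conic G (lsub (Ainv A) Q) (actp A p).
Proof.
move=> uA [[hL nL] iL]; split; last exact: inter_lsubV.
by split; [exact: dhomog_lsub | rewrite lsub_eq0 // unitmx_inv].
Qed.

Lemma flex_lsubV A G p : A \in unitmx ->
  flex_pt G (actp A p) -> flex_pt (lsub A G) p.
Proof.
move=> uA h; rewrite -[p](actpK uA); apply: flex_lsub; first by rewrite unitmx_inv.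
by rewrite lsubK.
Qed.

Lemma sextactic_lsub A G p : A \in unitmx ->
  sextactic_pt (lsub A G) p -> sextactic_pt G (actp A p).
Proof.
move=> uA [sm [nf [Q hQ]]]; split; first exact: smooth_lsub.
split; first by move/(flex_lsubV uA).
by exists (lsub (Ainv A) Q); apply: hyperosc_lsub.
Qed.

Lemma sextactic_lsubV A G p : A \in unitmx ->
  sextactic_pt G p -> sextactic_pt (lsub A G) (actp (Ainv A) p).
Proof.
move=> uA h; apply: sextactic_lsub; first by rewrite unitmx_inv.
by rewrite lsubK.
Qed.

(* Syzygies are contravariant in the coordinates, hence the inverse matrix. *)
Definition syz_lsub A (rho : 'I_3 -> S) : 'I_3 -> S :=
  actS (Ainv A) (fun k => lsub A (rho k)).

Lemma syz_lsubK A : A \in unitmx -> cancel (syz_lsub A) (syz_lsub (Ainv A)).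
Proof.
move=> uA rho; rewrite /syz_lsub invmxK.
have -> : (fun k => lsub (Ainv A) (actS (Ainv A) (fun k => lsub A (rho k)) k)) =
   actS (Ainv A) rho.
  apply: funext => k; rewrite (rmorph_actm _ (lsub (Ainv A))) /actm.
  by apply: eq_bigr => j _; rewrite /= lsubC lsubK.
by rewrite -actm_mul mulmxV // actm1.
Qed.

Lemma syz_lsubVK A : A \in unitmx -> cancel (syz_lsub (Ainv A)) (syz_lsub A).
Proof.
move=> uA rho; have uV : Ainv A \in unitmx by rewrite unitmx_inv.
by rewrite -{2}[rho](syz_lsubK uV) invmxK.
Qed.

Lemma actm_adj (T : comNzRingType) (f : {rmorphism C -> T}) (A : 'M[C]_3) u v :
  \sum_i u i * actm f A^T v i = \sum_i actm f A u i * v i.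
Proof.
transitivity (\sum_i \sum_j f (A j i) * u i * v j).
  apply: eq_bigr => i _; rewrite mulr_sumr; apply: eq_bigr => j _.
  by rewrite mxE; ring.
rewrite exchange_big; apply: eq_bigr => j _; rewrite mulr_suml.
by apply: eq_bigr.
Qed.

(** The chain rule multiplies the gradient by the transpose of [A]; [actm_adj] shifts this factor to
    the syzygy, where it cancels against the inverse matrix. *)
Lemma syzygy_lsub A G rho : A \in unitmx ->
  syzygy G rho -> syzygy (lsub A G) (syz_lsub A rho).
Proof.
move=> uA h; rewrite /syzygy.
under eq_bigr do rewrite mderiv_lsub.
rewrite actm_adj /syz_lsub -actm_mul mulmxV // actm1.
have := congr1 (lsub A) h; rewrite /= rmorph0 rmorph_sum => hs.
by rewrite -[RHS]hs; apply: eq_bigr => i _; rewrite rmorphM.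
Qed.

Lemma syz_lsub_comb A m (P : pred 'I_m) (g : 'I_m -> S) (rho : 'I_m -> 'I_3 -> S) :
  syz_lsub A (fun i => \sum_(j < m | P j) g j * rho j i) =
  fun i => \sum_(j < m | P j) lsub A (g j) * syz_lsub A (rho j) i.
Proof.
apply: funext => i; rewrite /syz_lsub /actm.
under eq_bigr do rewrite rmorph_sum mulr_sumr.
rewrite exchange_big; apply: eq_bigr => j _; rewrite mulr_sumr.
by apply: eq_bigr => k _; rewrite /= rmorphM mulrCA.
Qed.

Lemma syz_lsub0 A : syz_lsub A (fun=> 0) = fun=> 0.
Proof.
rewrite -[RHS](actm0 (@mpolyC 3 C : {rmorphism _ -> _}) (Ainv A)).
by rewrite /syz_lsub rmorph0.
Qed.

Lemma homog_syzygy_lsub A G r rho : A \in unitmx ->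
  homog_syzygy G r rho -> homog_syzygy (lsub A G) r (syz_lsub A rho).
Proof.
move=> uA [s [h nz]]; split; first exact: syzygy_lsub.
split=> [i|].
  by apply: rpred_sum => j _; rewrite mul_mpolyC rpredZ // dhomog_lsub.
have [//|hn] := pselect (exists i, syz_lsub A rho i != 0).
have z : syz_lsub A rho = fun=> 0.
  apply: funext => j; apply/eqP/negPn/negP => nz'; apply: hn; by exists j.
by case: nz => i; rewrite -[rho](syz_lsubK uA) z syz_lsub0 eqxx.
Qed.

Lemma generates_lsub A G m (rho : 'I_m -> 'I_3 -> S) : A \in unitmx ->
  generates_AR G rho -> generates_AR (lsub A G) (fun j => syz_lsub A (rho j)).
Proof.
move=> uA h a sa.
have /h [g hg] : syzygy G (syz_lsub (Ainv A) a).
  by rewrite -[G](lsubK uA); apply: syzygy_lsub; rewrite ?unitmx_inv.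
exists (fun j => lsub A (g j)) => i.
rewrite -[a](syz_lsubVK uA) (funext hg).
exact: (congr1 (fun u => u i) (syz_lsub_comb A predT g rho)).
Qed.

Lemma free_curve_lsub A G d1 d2 : A \in unitmx ->
  free_curve G d1 d2 -> free_curve (lsub A G) d1 d2.
Proof.
move=> uA [r1 [r2 [h1 [h2 [hg hi]]]]].
exists (syz_lsub A r1), (syz_lsub A r2).
split; first exact: homog_syzygy_lsub.
split; first exact: homog_syzygy_lsub.
split.
  have := generates_lsub uA hg; congr (generates_AR _ _).
  by apply: funext => j; case: ifP.
move=> g1 g2 hz.
have [|e1 e2] := hi (lsub (Ainv A) g1) (lsub (Ainv A) g2).
  have uV : Ainv A \in unitmx by rewrite unitmx_inv.
  (* The relation is rewritten as a sum over ['I_2] so that [syz_lsub_comb], applied to the inverse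
     matrix, carries it back to [r1] and [r2]. *)
  pose g := fun j : 'I_2 => if j == ord0 then g1 else g2.
  pose r := fun j : 'I_2 => if j == ord0 then syz_lsub A r1 else syz_lsub A r2.
  have z0 : (fun i => \sum_j g j * r j i) = fun=> 0.
    by apply: funext => k; rewrite !big_ord_recl big_ord0 addr0 [LHS]hz.
  have := syz_lsub_comb (Ainv A) predT g r; rewrite z0 syz_lsub0.
  move=> /(congr1 (fun u : 'I_3 -> S => u _)) E i; move: (E i).
  by rewrite /g /r !big_ord_recl big_ord0 /= !syz_lsubK // addr0 => <-.
split; first by rewrite -[g1](lsubVK uA) e1 rmorph0.
by rewrite -[g2](lsubVK uA) e2 rmorph0.
Qed.

Lemma msyzygy_curve_lsub A G m (d : 'I_m -> nat) : A \in unitmx ->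
  msyzygy_curve G d -> msyzygy_curve (lsub A G) d.
Proof.
move=> uA [rho [h1 [h2 h3]]]; exists (fun j => syz_lsub A (rho j)).
split; first by move=> j; apply: homog_syzygy_lsub.
split; first exact: generates_lsub.
move=> j0 [g hg]; apply: (h3 j0); exists (fun j => lsub (Ainv A) (g j)) => i.
have /(congr1 (syz_lsub (Ainv A))) := funext hg.
rewrite syz_lsubK // syz_lsub_comb => /(congr1 (fun u => u i)) ->.
by apply: eq_bigr => j _; rewrite syz_lsubK.
Qed.

Lemma syzygyZ (c : C) G rho : c != 0 -> syzygy (c *: G) rho <-> syzygy G rho.
Proof.
move=> nc; rewrite /syzygy; under eq_bigr do rewrite mderivZ -scalerAr.
rewrite -scaler_sumr; split=> [/eqP|->]; last by rewrite scaler0.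
by rewrite scaler_eq0 (negbTE nc) => /eqP.
Qed.

Lemma free_curveZ (c : C) G d1 d2 : c != 0 ->
  free_curve G d1 d2 -> free_curve (c *: G) d1 d2.
Proof.
move=> nc [r1 [r2 [[s1 h1] [[s2 h2] [hg hi]]]]]; exists r1, r2.
do 2![split; first by split=> //; apply/syzygyZ].
by split=> // a /(syzygyZ _ _ nc); apply: hg.
Qed.

Lemma msyzygy_curveZ (c : C) G m (d : 'I_m -> nat) : c != 0 ->
  msyzygy_curve G d -> msyzygy_curve (c *: G) d.
Proof.
move=> nc [rho [h1 [h2 h3]]]; exists rho.
split; first by move=> j; case: (h1 j) => s h; split=> //; apply/syzygyZ.
by split=> // a /(syzygyZ _ _ nc); apply: h2.
Qed.

End Transport.

(** * The nodal cubic and its osculating conics *)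

Section Homogeneous.
Variable C : numClosedFieldType.
Local Notation S := {mpoly C[3]}.

Lemma mderiv_exp n (R : comNzRingType) (p : {mpoly R[n]}) i k :
  (p ^+ k)^`M(i) = k%:R * p ^+ k.-1 * p^`M(i).
Proof.
elim: k => [|k IH]; first by rewrite expr0 mul0r mul0r -mpolyC1 mderivC.
rewrite exprS mderivM IH /=; case: k {IH} => [|k] /=.
  by rewrite !mul0r mulr0 expr0 !mulr1 mul1r addr0.
rewrite exprS; ring.
Qed.

Lemma mderiv_nat n (R : comNzRingType) i k : (k%:R : {mpoly R[n]})^`M(i) = 0.
Proof. by rewrite -mpolyC_nat mderivC. Qed.

Lemma mderiv_X n (R : comNzRingType) (i j : 'I_n) :
  ('X_i : {mpoly R[n]})^`M(j) = (i == j)%:R.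
Proof.
rewrite mderivX mnm1E; case: eqP => [->|_]; last by rewrite scale0r.
rewrite scale1r (_ : (U_(j) - U_(j))%MM = 0%MM) ?mpolyX0 //.
by apply/mnmP => l; rewrite mnmBE mnm0E subnn.
Qed.

Lemma meval_exp n (R : comNzRingType) v k :
  {morph (@meval n R v) : p / p ^+ k >-> p ^+ k}.
Proof. exact: rmorphXn. Qed.

Lemma meval_nat n (R : comNzRingType) v k : (k%:R : {mpoly R[n]}).@[v] = k%:R.
Proof. exact: rmorph_nat. Qed.

Lemma dhomog_mderiv n (R : comNzRingType) d (p : {mpoly R[n]}) i :
  p \is d.+1.-homog -> p^`M(i) \is d.-homog.
Proof.
move=> /dhomogP hp; apply/dhomogP => m; rewrite mcoeff_msupp mcoeff_mderiv => nz.
have /hp /= : (m + U_(i))%MM \in msupp p.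
  by rewrite mcoeff_msupp; apply: contraNneq nz => ->; rewrite mul0rn.
by rewrite mdegD mdeg1 addn1 => -[].
Qed.

Lemma homog0E (p : S) : p \is 0.-homog -> exists a, p = a%:MP.
Proof.
move=> hp; exists p@_0; apply/mpolyP => m; rewrite mcoeffC.
have [->|nz] := eqVneq 0%MM m; first by rewrite mulr1.
by rewrite mulr0 (dhomog_nemf_coeff hp) //= mdeg_eq0 eq_sym.
Qed.

Lemma natS_neq0 k : (k.+1%:R : S) != 0.
Proof. by rewrite -mpolyC_nat mpolyC_eq0 pnatr_eq0. Qed.

Lemma natS_inj k (p q : S) : k.+1%:R * p = k.+1%:R * q -> p = q.
Proof. exact/mulfI/natS_neq0. Qed.

Lemma homog1E (p : S) : p \is 1.-homog -> exists a b c : C,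
  p = a%:MP * 'X_o0 + b%:MP * 'X_o1 + c%:MP * 'X_o2.
Proof.
move=> hp; have [a ea] := homog0E (dhomog_mderiv o0 hp).
have [b eb] := homog0E (dhomog_mderiv o1 hp).
have [c ec] := homog0E (dhomog_mderiv o2 hp).
exists a, b, c; have := euler_homog hp; rewrite mul1r => <-.
by rewrite sum_I3 ea eb ec; ring.
Qed.

Lemma homog2E (p : S) : p \is 2.-homog -> exists a b c d e f : C,
  p = a%:MP * 'X_o0 ^+ 2 + b%:MP * ('X_o0 * 'X_o1) + c%:MP * 'X_o1 ^+ 2
    + d%:MP * ('X_o0 * 'X_o2) + e%:MP * ('X_o1 * 'X_o2) + f%:MP * 'X_o2 ^+ 2.
Proof.
move=> hp; have [a1 [b1 [c1 e1]]] := homog1E (dhomog_mderiv o0 hp).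
have [a2 [b2 [c2 e2]]] := homog1E (dhomog_mderiv o1 hp).
have [a3 [b3 [c3 e3]]] := homog1E (dhomog_mderiv o2 hp).
have := euler_homog hp; rewrite sum_I3 e1 e2 e3 => E.
exists (a1 / 2), ((b1 + a2) / 2), (b2 / 2), ((c1 + a3) / 2), ((c2 + b3) / 2), (c3 / 2).
have h c : c%:MP = 2 * (c / 2)%:MP :> S.
  by rewrite -[2]mpolyC_nat -mpolyCM mulrC divfK // pnatr_eq0.
apply: (@natS_inj 1); rewrite -E !mulrDr !mulrA -!h !mpolyCD; ring.
Qed.

Lemma homog3E (p : S) : p \is 3.-homog -> exists c0 c1 c2 c3 c4 c5 c6 c7 c8 c9 : C,
  p = c0%:MP * 'X_o0 ^+ 3 + c1%:MP * ('X_o0 ^+ 2 * 'X_o1)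
    + c2%:MP * ('X_o0 * 'X_o1 ^+ 2) + c3%:MP * 'X_o1 ^+ 3
    + c4%:MP * ('X_o0 ^+ 2 * 'X_o2) + c5%:MP * ('X_o0 * 'X_o1 * 'X_o2)
    + c6%:MP * ('X_o1 ^+ 2 * 'X_o2) + c7%:MP * ('X_o0 * 'X_o2 ^+ 2)
    + c8%:MP * ('X_o1 * 'X_o2 ^+ 2) + c9%:MP * 'X_o2 ^+ 3.
Proof.
move=> hp; have [a1 [b1 [c1 [d1 [g1 [f1 e1]]]]]] := homog2E (dhomog_mderiv o0 hp).
have [a2 [b2 [c2 [d2 [g2 [f2 e2]]]]]] := homog2E (dhomog_mderiv o1 hp).
have [a3 [b3 [c3 [d3 [g3 [f3 e3]]]]]] := homog2E (dhomog_mderiv o2 hp).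
have := euler_homog hp; rewrite sum_I3 e1 e2 e3 => E.
exists (a1 / 3), ((b1 + a2) / 3), ((c1 + b2) / 3), (c2 / 3), ((d1 + a3) / 3),
  ((g1 + d2 + b3) / 3), ((g2 + c3) / 3), ((f1 + d3) / 3), ((f2 + g3) / 3), (f3 / 3).
have h c : c%:MP = 3 * (c / 3)%:MP :> S.
  by rewrite -[3]mpolyC_nat -mpolyCM mulrC divfK // pnatr_eq0.
apply: (@natS_inj 2); rewrite -E !mulrDr !mulrA -!h !mpolyCD; ring.
Qed.

Lemma vanishesP (q : {poly C}) k :
  vanishes_to_order q k <-> exists r, q = 'X^k * r.
Proof.
split=> [h|[r ->] i ik]; last by rewrite coefXnM ik.
exists (drop_poly k q); rewrite -{1}[q](poly_take_drop k) mulrC.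
rewrite (_ : take_poly k q = 0) ?add0r //.
by apply/polyP => i; rewrite coef_take_poly coef0; case: ifP => // /h.
Qed.

End Homogeneous.

Section NodalCubic.
Variable C : numClosedFieldType.
Local Notation S := {mpoly C[3]}.

(** The ring is arbitrary so that one expression serves for coordinates of points, for jets in
    [{poly C}] and for the variables of [S]. *)
Definition nodal (T : comNzRingType) (x y z : T) : T := x * y * z - x ^+ 3 - y ^+ 3.

(** The coefficients solve Q(t, t^2, 1 + t^3) = (t - w)^6 when w^3 = 1: for instance 21 = 15 + 6 and
    -22 = -20 - 2, where 6 and 2 correct for the terms of xz, yz and z^2 in the same degrees. *)
Definition conic (T : comNzRingType) (w x y z : T) : T :=
  z ^+ 2 - 6 * w ^+ 2 * x * z - 6 * w * y * z + 21 * w * x ^+ 2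
  + 21 * w ^+ 2 * y ^+ 2 - 22 * x * y.

Definition nodal_cubic : S := nodal 'X_o0 'X_o1 'X_o2.
Definition osc_conic (w : C) : S := conic w%:MP 'X_o0 'X_o1 'X_o2.

Lemma rmorph_nodal (T T' : comNzRingType) (g : {rmorphism T -> T'}) x y z :
  g (nodal x y z) = nodal (g x) (g y) (g z).
Proof. by rewrite /nodal !(rmorphXn, rmorphM, rmorphB). Qed.

Lemma rmorph_conic (T T' : comNzRingType) (g : {rmorphism T -> T'}) w x y z :
  g (conic w x y z) = conic (g w) (g x) (g y) (g z).
Proof. by rewrite /conic !(rmorph_nat, rmorphXn, rmorphM, rmorphB, rmorphD). Qed.

Lemma mmap_nodal (T : comNzRingType) (f : {rmorphism C -> T}) h :
  mmap f h nodal_cubic = nodal (h o0) (h o1) (h o2).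
Proof. by rewrite (rmorph_nodal (mmap f h)) /= !mmap_U. Qed.

Lemma mmap_conic (T : comNzRingType) (f : {rmorphism C -> T}) h w :
  mmap f h (osc_conic w) = conic (f w) (h o0) (h o1) (h o2).
Proof. by rewrite (rmorph_conic (mmap f h)) /= !mmap_U mmapC. Qed.

Lemma meval_nodal p : nodal_cubic.@[p] = nodal (p o0) (p o1) (p o2).
Proof. exact: (mmap_nodal (@idfun C)). Qed.

Lemma dhomog_X (i : 'I_3) : ('X_i : S) \is 1.-homog.
Proof. by rewrite dhomogX /= mdeg1. Qed.

Lemma dhomog_C (c : C) : (c%:MP : S) \is 0.-homog.
Proof. by rewrite -[c%:MP]mulr1 mul_mpolyC rpredZ // dhomog1. Qed.

Lemma dhomog_nat k : (k%:R : S) \is 0.-homog.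
Proof. by rewrite -mpolyC_nat dhomog_C. Qed.

Lemma nodal_homog : nodal_cubic \is 3.-homog.
Proof.
have h i : ('X_i : S) ^+ 3 \is 3.-homog by apply: (dhomogMn 3 (dhomog_X i)).
rewrite !rpredB // ?h //.
by apply: (@dhomogM _ _ _ 2); [apply: (@dhomogM _ _ _ 1)|]; exact: dhomog_X.
Qed.

Lemma conic_homog w : osc_conic w \is 2.-homog.
Proof.
have h (c : C) i j : c%:MP * ('X_i * 'X_j) \is [in C[3], 2.-homog].
  by apply: (@dhomogM _ _ _ 0); [exact: dhomog_C | apply: (@dhomogM _ _ _ 1); exact: dhomog_X].
have -> : osc_conic w = 1%:MP * ('X_o2 * 'X_o2) - (6 * w ^+ 2)%:MP * ('X_o0 * 'X_o2)
  - (6 * w)%:MP * ('X_o1 * 'X_o2) + (21 * w)%:MP * ('X_o0 * 'X_o0)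
  + (21 * w ^+ 2)%:MP * ('X_o1 * 'X_o1) - 22%:MP * ('X_o0 * 'X_o1).
  by rewrite /osc_conic /conic !(mpolyC_nat, rmorphXn, mpolyCM) /= mpolyC1; ring.
by rewrite !(rpredB, rpredD) // h.
Qed.
End NodalCubic.

(** * Contact orders read off the rational parametrization *)

Section Branches.
Variable C : numClosedFieldType.
Local Notation S := {mpoly C[3]}.
Local Notation N := (nodal_cubic C).

Definition cubic_param : 'I_3 -> {poly C} := vec3 'X ('X ^+ 2) (1 + 'X ^+ 3).

Lemma compose_mmap_congr (G : S) (D : {poly C}) u v :
  (forall i, exists k, u i - v i = D * k) ->
  exists k, compose G u - compose G v = D * k.
Proof. by move=> h; apply: (@mmap_congr _ _ _ (@polyC C : {rmorphism _ -> _})). Qed.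

Lemma compose_comp_poly (G : S) u (t : {poly C}) :
  compose G u \Po t = compose G (fun i => u i \Po t).
Proof.
exact: (@rmorph_mmap _ _ _ _ (@polyC C : {rmorphism _ -> _})
  (@polyC C : {rmorphism _ -> _}) (comp_poly t : {rmorphism _ -> _}) u
  (fun c => comp_polyC c t)).
Qed.

Lemma compose_homog (G : S) d u t : G \is d.-homog ->
  compose G (fun i => t * u i) = t ^+ d * compose G u.
Proof. exact: (mmap_homog (@polyC C : {rmorphism _ -> _})). Qed.

Lemma compose_nodal u : compose N u = nodal (u o0) (u o1) (u o2).
Proof. exact: (mmap_nodal (@polyC C : {rmorphism _ -> _})). Qed.

Lemma compose_nodal_param : compose N cubic_param = 0.
Proof. by rewrite compose_nodal /nodal /cubic_param /vec3 /=; ring. Qed.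

Lemma factor_at_zero (p : {poly C}) : exists q,
  p = p.[0]%:P + 'X * q /\ q.[0] = p^`().[0].
Proof.
exists (drop_poly 1 p).
have E : p = p.[0]%:P + 'X * drop_poly 1 p.
  rewrite -{1}[p](poly_take_drop 1) mulrC horner_coef0; congr (_ + _).
  by apply/polyP => -[|i]; rewrite coef_take_poly coefC.
split=> //; rewrite [in RHS]E derivD derivM derivC derivX.
by rewrite !hornerE.
Qed.

(* On the branch, (x y)(x, y, z) = (x^2 y, x y^2, x^3 + y^3) = x^3 (t, t^2, 1 + t^3)
   with t = y / x, and t is a local parameter since the branch is immersed. *)
Lemma branch_order d (G : S) p k : G \is d.-homog -> (1 < k)%N ->
  p o0 != 0 -> p o1 != 0 -> intersection_mult_ge N G p k ->
  exists q, compose G cubic_param = ('X - (p o1 / p o0)%:P) ^+ k * q.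
Proof.
move=> hG k1 nx ny [g [g0 [g1 [/vanishesP [s hs] /vanishesP [r hr]]]]].
set t0 := p o1 / p o0.
set x := g o0; set y := g o1; set z := g o2.
have x0 : x.[0] = p o0 by apply: g0.
have y0 : y.[0] = p o1 by apply: g0.
have z0 : z.[0] = p o2 by apply: g0.
have hsN : nodal x y z = 'X^k * s by rewrite -hs compose_nodal.
(* [w] inverts [x] modulo ['X^k], which is possible because [x] does not vanish at 0. *)
have [w [v wv]] : exists w v, w * x - 1 = 'X^k * v.
  have /Bezout_eq1_coprimepP [[a b] /= ab] : coprimep x 'X^k.
    by apply: coprimep_expr; rewrite coprimepX rootE x0.
  by exists a, (- b); rewrite -ab; ring.
(* As [1 < k], multiples of ['X^k] have zero value and zero derivative at 0, so first-order data may
   be read off congruences modulo ['X^k]. *)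
have [D D0] : exists D : {poly C}, 'X^k = 'X * ('X * D).
  by exists 'X^(k.-2); rewrite -!exprS; case: k k1 {hs hr hsN wv} => [|[]].
have d0 (u : {poly C}) : ('X^k * u)^`().[0] = 0.
by rewrite D0 !derivM derivX !hornerE.
have w0 : w.[0] = (p o0)^-1.
  apply: (mulIf nx); rewrite mulVf //.
  have /(congr1 (fun u => u.[0])) := wv.
  by rewrite D0 !hornerE x0 => /eqP; rewrite ?mul0r subr_eq0 => /eqP.
pose t := w * y.
have t0E : t.[0] = t0 by rewrite hornerM w0 y0 mulrC.
have t1 : t^`().[0] != 0.
  (* If t' vanished at 0, then y'/y = x'/x there, and the derivative of the cubic equation would
     give z' the same ratio to z. The velocity would be proportional to [p], which immersion
     excludes. *)
  apply/eqP => t10; apply: g1; exists (x^`().[0] / p o0).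
  have e1 : w^`().[0] * p o0 = - ((p o0)^-1 * x^`().[0]).
    have := congr1 (fun u => u^`().[0]) wv.
    rewrite /= d0 derivB derivM -[1]polyC1 derivC subr0 hornerD !hornerM x0 w0.
    by move/eqP; rewrite addr_eq0 => /eqP.
  have e2 : y^`().[0] = x^`().[0] / p o0 * p o1.
    have : p o0 * (w^`().[0] * p o1 + (p o0)^-1 * y^`().[0]) = 0.
      by rewrite -w0 -y0 -!hornerM -hornerD -derivM -/t t10 mulr0.
    rewrite mulrDr mulrA [p o0 * _]mulrC e1 mulVKf // => /eqP.
    by rewrite addrC addr_eq0 => /eqP ->; ring.
  have Np : p o0 * p o1 * p o2 = p o0 ^+ 3 + p o1 ^+ 3.
    have := congr1 (fun u => u.[0]) hsN.
    rewrite /= D0 /nodal !hornerE /= x0 y0 z0 ?mul0r -addrA -opprD => /eqP.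
    by rewrite subr_eq0 => /eqP.
  have e3 : z^`().[0] = x^`().[0] / p o0 * p o2.
    have hs3 : x * y * z - x * x * x - y * y * y = 'X^k * s.
      by rewrite -hsN /nodal; ring.
    have := congr1 (fun u => u^`().[0]) hs3.
    rewrite /= d0 !derivB !derivM !hornerE x0 y0 z0.
    move=> E; apply: (mulfI nx); apply: (mulfI ny).
    move: E; rewrite e2 => E.
    have nE : x^`().[0] = x^`().[0] / p o0 * p o0 by rewrite divfK.
    move: E; set c := x^`().[0] / p o0 in nE *; rewrite nE.
    move: (z^`().[0]) => z1 {}E; apply/eqP; rewrite -subr_eq0; apply/eqP.
    transitivity (0 - 3 * c * (p o0 * p o1 * p o2 - (p o0 ^+ 3 + p o1 ^+ 3))).
      by rewrite -E; ring.
    by rewrite Np subrr mulr0 subr0.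
  by elim/I3_ind; rewrite -?/x -?/y -?/z ?e2 ?e3 // divfK.
have [sg [tE sg0]] := factor_at_zero t.
have {}sg0 : sg.[0] != 0 by rewrite sg0.
rewrite t0E in tE.
have [m hm] : exists m, (compose G cubic_param) \Po t = 'X^k * m.
  (* Modulo ['X^k], multiplying by [w ^+ 3] is dividing by x^3, so [U] times the jet is congruent to
     the parametrization at [t]. *)
  pose U := x * y * w ^+ 3.
  have [i|m hm] := @compose_mmap_congr G 'X^k (fun i => U * g i)
    (fun i => cubic_param i \Po t).
    have Xt j : 'X^j \Po t = t ^+ j by rewrite rmorphXn /= comp_polyX.
    elim/I3_ind: i; rewrite /cubic_param /vec3 /= ?rmorphD /= ?Xt ?comp_polyX
      ?rmorph1 -/x -/y -/z.
    - exists (v * (w * x + 1) * w * y).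
      by rewrite !mulrA -wv /U /t; ring.
    - exists (v * w ^+ 2 * y ^+ 2).
      by rewrite !mulrA -wv /U /t; ring.
    exists (w ^+ 3 * s + v * ((w * x) ^+ 2 + w * x + 1)).
    rewrite mulrDr mulrCA -hsN !mulrA -wv /U /t /nodal; ring.
  rewrite compose_comp_poly; exists (U ^+ d * r - m).
  have E : compose G (fun i => U * g i) = 'X^k * (U ^+ d * r).
    by rewrite (compose_homog _ _ hG) hr mulrCA.
  by rewrite mulrBr -E -hm; ring.
set P := compose G cubic_param in hm *.
have [->|nP] := eqVneq P 0; first by exists 0; rewrite mulr0.
(* Since [t] minus [t0] is ['X] times [sg] with [sg.[0] != 0], substituting [t] preserves
   multiplicities: if [n < k], cancelling ['X^n] and evaluating at 0 makes [t0] a root of the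
   cofactor [q]. *)
have [n [q hq PE]] := multiplicity_XsubC P t0.
have [kn|nk] := leqP k n.
  exists (q * ('X - t0%:P) ^+ (n - k)).
  by rewrite mulrCA -exprD subnKC // mulrC.
case/negP: (implyP hq nP); move: hm; rewrite PE rmorphM rmorphXn /= rmorphB /=.
rewrite comp_polyX comp_polyC tE addrAC subrr add0r exprMn -(subnKC nk).
rewrite addSnnS exprD -mulrA => E.
have Xn0 : 'X^n != 0 :> {poly C} by rewrite monic_neq0 ?monicXn.
have {}E : (q \Po t) * sg ^+ n = 'X^((k - n.+1).+1) * m.
  by apply: (mulfI Xn0); rewrite -E -tE; ring.
have /eqP := congr1 (fun u => u.[0]) E.
rewrite /= exprS -mulrA !hornerM horner_comp hornerX mul0r t0E mulf_eq0.
by rewrite horner_exp expf_eq0 (negbTE sg0) andbF orbF.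
Qed.

(* Near p, the cubic is traced by the multiple of [cubic_param] shifted to p. *)
Lemma branch_param d (G : S) p k : G \is d.-homog ->
  p o0 != 0 -> p o1 != 0 -> on_curve N p ->
  (exists q, compose G cubic_param = ('X - (p o1 / p o0)%:P) ^+ k * q) ->
  intersection_mult_ge N G p k.
Proof.
move=> hG nx ny; rewrite /on_curve meval_nodal => hN.
set t0 := p o1 / p o0 => -[q hq].
have nt : t0 != 0 by rewrite mulf_neq0 // invr_eq0.
pose l : {poly C} := (p o0 / t0)%:P.
exists (fun i => l * (cubic_param i \Po ('X + t0%:P))).
have shift : ('X - t0%:P) \Po ('X + t0%:P) = 'X.
  by rewrite rmorphB /= comp_polyX comp_polyC addrK.
have z0 : p o2 = p o0 / t0 * (1 + t0 ^+ 3).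
  apply: (mulfI nx); apply: (mulfI ny); apply/eqP; rewrite -subr_eq0; apply/eqP.
  by rewrite -[RHS]hN /nodal /t0; field; apply/andP.
have hl : p o0 / t0 * t0 = p o0 by rewrite divfK.
have val0 (u : {poly C}) : (u \Po ('X + t0%:P)).[0] = u.[t0].
  by rewrite horner_comp hornerD hornerX hornerC add0r.
have yE : p o0 * t0 = p o1 by rewrite mulrC divfK.
split.
  elim/I3_ind; rewrite hornerM hornerC val0 /cubic_param /vec3 /=.
  - by rewrite hornerX.
  - by rewrite hornerXn expr2 mulrA hl.
  by rewrite hornerD hornerXn -[1]polyC1 hornerC.
split.
  (* The first coordinate gives p0 / t0 = c p0. The second coordinate then has derivative 2 p0,
     while c p1 = p0; hence p0 = 0. *)
  move=> [c hc].
  have val1 (u : {poly C}) : (l * (u \Po ('X + t0%:P)))^`().[0] = p o0 / t0 * u^`().[t0].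
    by rewrite derivM derivC mul0r add0r hornerM hornerC deriv_comp hornerM val0
      derivD derivX derivC addr0 -[1]polyC1 hornerC mulr1.
  have := hc o1; have := hc o0.
  rewrite !val1 /cubic_param /vec3 /= derivX derivXn hornerMn hornerXn -[1]polyC1 hornerC.
  rewrite mulr1 expr1 -mulr_natr mulrA hl => e1.
  rewrite -yE mulrA -e1 hl => /eqP; rewrite -subr_eq0.
  by rewrite (_ : _ - _ = p o0); [rewrite (negbTE nx) | ring].
split; apply/vanishesP.
  exists 0; rewrite (compose_homog _ _ (nodal_homog C)) -compose_comp_poly.
  by rewrite compose_nodal_param rmorph0 !mulr0.
exists (l ^+ d * (q \Po ('X + t0%:P))).
by rewrite (compose_homog _ _ hG) -compose_comp_poly hq rmorphM rmorphXn /= shift mulrCA.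
Qed.

End Branches.

(** * Sextactic points, flexes and hyperosculating conics of the normal form *)

Section Sextactic.
Variable C : numClosedFieldType.
Local Notation S := {mpoly C[3]}.
Local Notation N := (nodal_cubic C).

Lemma grad_nodal : [/\ N^`M(o0) = 'X_o1 * 'X_o2 - 3 * 'X_o0 ^+ 2,
  N^`M(o1) = 'X_o0 * 'X_o2 - 3 * 'X_o1 ^+ 2 & N^`M(o2) = 'X_o0 * 'X_o1].
Proof.
by split; rewrite /nodal_cubic /nodal !(mderivB, mderivM, mderiv_exp, mderiv_X) /=; ring.
Qed.

(** On the curve xyz = x^3 + y^3, so if one of x, y vanishes then both do; that point is the node,
    where the gradient is zero. *)
Lemma smooth_nodal p : smooth_pt N p -> p o0 != 0 /\ p o1 != 0.
Proof.
case: grad_nodal => g0 g1 g2 [_ [on [i gi]]].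
have X (j : 'I_3) : ('X_j : S).@[p] = p j by rewrite mevalXU.
have nat3 : (3 : S).@[p] = 3 by rewrite rmorph_nat.
move: on; rewrite /on_curve meval_nodal /nodal => on.
suff : p o0 * p o1 != 0 by rewrite mulf_eq0 negb_or => /andP[].
apply/eqP => xy0; move: on; rewrite xy0 mul0r sub0r => /eqP.
rewrite -opprD oppr_eq0 => /eqP on.
have [x0 y0] : p o0 = 0 /\ p o1 = 0.
  move/eqP: xy0; rewrite mulf_eq0 => /orP[] /eqP e; split=> //;
    move: on; rewrite e expr0n /= ?add0r ?addr0 => /eqP; by rewrite expf_eq0 => /eqP.
case/negP: gi; elim/I3_ind: i; rewrite ?g0 ?g1 ?g2 !(rmorphM, rmorphXn, rmorphB) /= ?rmorphM /=.
all: by rewrite !(X, nat3) x0 y0; apply/eqP; ring.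
Qed.

(** A form of degree d pulls back to a polynomial of degree at most 3d, so contact of order 3d,
    which is 3 for a line and 6 for a conic, leaves a constant cofactor by comparison of degrees. *)
Lemma Poly_factor (s : seq C) k w q :
  size s = k.+1 -> Poly s = ('X - w%:P) ^+ k * q -> exists c, q = c%:P.
Proof.
move=> hs E; have [->|nq] := eqVneq q 0; first by exists 0; rewrite polyC0.
exists q`_0; apply: size1_polyC.
have := size_Poly s; rewrite E hs size_proper_mul ?size_exp_XsubC.
  by rewrite /= -addn1 leq_add2l.
by rewrite (monicP (monic_exp _ (monicXsubC _))) mul1r lead_coef_eq0.
Qed.

Lemma compose_line (a b c : C) :
  compose (a%:MP * 'X_o0 + b%:MP * 'X_o1 + c%:MP * 'X_o2) (cubic_param C) =
  Poly [:: c; a; b; c].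
Proof.
rewrite /compose !(rmorphD, rmorphM) /= !mmap_U !mmapC /=.
by rewrite /cubic_param /vec3 /= !cons_poly_def; ring.
Qed.

(** The pullback has [c] as both its constant and its leading coefficient; comparing with [c] times
    (t - w)^3 gives the last equation, which forces w^3 = -1 unless the line is zero. *)
Lemma line_contact (a b c w : C) (L : S) q :
  L = a%:MP * 'X_o0 + b%:MP * 'X_o1 + c%:MP * 'X_o2 ->
  compose L (cubic_param C) = ('X - w%:P) ^+ 3 * q ->
  [/\ a = 3 * w ^+ 2 * c, b = - (3 * w * c) & c = - (w ^+ 3 * c)].
Proof.
move=> ->; rewrite compose_line => E.
have [k kE] := Poly_factor (s := [:: c; a; b; c]) erefl E.
have {}E : Poly [:: c; a; b; c] = Poly [:: - (w ^+ 3 * k); 3 * w ^+ 2 * k; - (3 * w * k); k].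
  by rewrite E kE /= !cons_poly_def; ring.
have coefE i : [:: c; a; b; c]`_i =
    [:: - (w ^+ 3 * k); 3 * w ^+ 2 * k; - (3 * w * k); k]`_i.
  by rewrite -[LHS]coef_Poly -[RHS]coef_Poly E.
have /= ck := coefE 3%N.
have /= bk := coefE 2%N.
have /= ak := coefE 1%N.
have /= ck' := coefE 0%N.
by rewrite -ck in ak bk ck'.
Qed.

Lemma conic_contact (a b c d e f w : C) (Q : S) q :
  Q = a%:MP * 'X_o0 ^+ 2 + b%:MP * ('X_o0 * 'X_o1) + c%:MP * 'X_o1 ^+ 2
    + d%:MP * ('X_o0 * 'X_o2) + e%:MP * ('X_o1 * 'X_o2) + f%:MP * 'X_o2 ^+ 2 ->
  compose Q (cubic_param C) = ('X - w%:P) ^+ 6 * q ->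
  [/\ f = w ^+ 6 * f, d = - (6 * w ^+ 5 * f) & e = - (6 * w * f)] /\
  [/\ a + e = 15 * w ^+ 4 * f, b + 2 * f = - (20 * w ^+ 3 * f)
    & c + d = 15 * w ^+ 2 * f].
Proof.
move=> ->; rewrite /compose !(rmorphXn, rmorphD, rmorphM) /= !mmap_U !mmapC /=.
rewrite /cubic_param /vec3 /= => E.
pose s := [:: f; d; a + e; b + 2 * f; c + d; e; f].
have {}E : Poly s = ('X - w%:P) ^+ 6 * q.
  by rewrite -E /s /= !cons_poly_def; ring.
have [k kE] := Poly_factor (s := s) erefl E.
pose s' := [:: w ^+ 6 * k; - (6 * w ^+ 5 * k); 15 * w ^+ 4 * k;
    - (20 * w ^+ 3 * k); 15 * w ^+ 2 * k; - (6 * w * k); k].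
have {}E : Poly s = Poly s'.
  by rewrite E kE /s' /= !cons_poly_def; ring.
have coefE i : s`_i = s'`_i by rewrite -[LHS]coef_Poly -[RHS]coef_Poly E.
have /= fk5 := coefE 5%N.
have /= fk4 := coefE 4%N.
have /= fk3 := coefE 3%N.
have /= fk2 := coefE 2%N.
have /= fk1 := coefE 1%N.
have /= fk0 := coefE 0%N.
have /= fk6 := coefE 6%N.
by rewrite -fk6 in fk0 fk1 fk2 fk3 fk4 fk5.
Qed.

(** This is the point (w, w^2, 1 + w^3) of the parametrization divided by w, simplified with w^3 =
    1. *)
Definition sext_pt (w : C) : 'I_3 -> C := vec3 1 w (2 * w ^+ 2).

Lemma compose_osc_conic (w : C) : w ^+ 3 = 1 ->
  compose (osc_conic w) (cubic_param C) = ('X - w%:P) ^+ 6 * 1.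
Proof.
move=> w3; have W : w%:P ^+ 3 = 1 :> {poly C} by rewrite -rmorphXn /= w3.
rewrite /compose (mmap_conic (@polyC C : {rmorphism _ -> _})) /cubic_param /vec3 /=.
rewrite /conic mulr1; apply/eqP; rewrite -subr_eq0; apply/eqP.
transitivity ((1 - w%:P ^+ 3) * (1 + w%:P ^+ 3 - 6 * w%:P ^+ 2 * 'X
    + 15 * w%:P * 'X ^+ 2 - 20 * 'X ^+ 3)); first ring.
by rewrite W subrr mul0r.
Qed.

Lemma osc_conic_neq0 (w : C) : osc_conic w != 0.
Proof.
apply/eqP => /(congr1 (meval (vec3 0 0 1))).
rewrite /meval (mmap_conic (@idfun C)) /conic /vec3 /= rmorph0 => /eqP.
by rewrite !(mulr0, expr0n, mul0r) /= expr1n !(subr0, addr0) oner_eq0.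
Qed.

Lemma sextactic_nodal p : sextactic_pt N p ->
  exists w, w ^+ 3 = 1 /\ same_pt (sext_pt w) p.
Proof.
move=> [sm [nf [Q [[hQ nQ] iQ]]]]; have [nx ny] := smooth_nodal sm.
have on : on_curve N p by case: sm => _ [].
have [t tE] : exists t, p o1 / p o0 = t by exists (p o1 / p o0).
exists t.
have nt : t != 0 by rewrite -tE mulf_neq0 ?invr_eq0.
have [q hq] := branch_order hQ (isT : (1 < 6)%N) nx ny iQ.
have [a [b [c [d [e [f QE]]]]]] := homog2E hQ.
have [[h0 h1 h2] [h3 h4 h5]] := conic_contact QE hq.
rewrite tE in h0 h1 h2 h3 h4 h5.
(* If [f = 0], the equations of [conic_contact] successively kill [d], [e], [a], [b] and [c]. *)
have nf0 : f != 0.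
  apply: contraNneq nQ => f0; rewrite QE; move: h3 h4 h5.
  rewrite h1 h2 f0 !(mulr0, oppr0, addr0) => -> -> ->.
  by rewrite mpolyC0 !mul0r !addr0.
have t6 : t ^+ 6 = 1 by apply: (mulIf nf0); rewrite -h0 mul1r.
have t3 : t ^+ 3 = 1.
  have : (t ^+ 3 - 1) * (t ^+ 3 + 1) = 0.
    by transitivity (t ^+ 6 - 1); [ring | rewrite t6 subrr].
  move/eqP; rewrite mulf_eq0 subr_eq0 => /orP[/eqP //|]; rewrite addr_eq0 => /eqP t3.
  case: nf; split=> //.
  (* When t^3 = -1 this line pulls back to exactly (X - t)^3, so it is an inflectional tangent and
     the point is a flex. *)
  pose L : S := (3 * t ^+ 2)%:MP * 'X_o0 + (- (3 * t))%:MP * 'X_o1 + 1%:MP * 'X_o2.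
  have hL : L \is 1.-homog.
    by rewrite /L !mul_mpolyC !rpredD // rpredZ ?dhomog_X.
  exists L; split.
    split=> //; apply/eqP => /(congr1 (meval (vec3 0 0 1))).
    rewrite /L meval0 !(rmorphD, rmorphM) /= !mevalXU !mevalC /vec3 /= => /eqP.
    by rewrite !mulr0 !add0r mulr1 oner_eq0.
  apply: (branch_param hL nx ny on); exists 1; rewrite mulr1 tE.
  rewrite compose_line /= !cons_poly_def.
  have T : t%:P ^+ 3 = -1 :> {poly C} by rewrite -rmorphXn /= t3 polyCN polyC1.
  transitivity (('X - t%:P) ^+ 3 + (t%:P ^+ 3 + 1)); last by rewrite T addNr addr0.
  by rewrite polyCN !(rmorph_nat, rmorphXn, polyCM, polyC1) /=; ring.
split=> //; exists (p o0); split=> //; elim/I3_ind; rewrite /sext_pt /vec3 /=.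
- by rewrite mulr1.
- by rewrite -tE mulrC divfK.
move: on; rewrite /on_curve meval_nodal /nodal => on.
apply: (mulfI nx); apply: (mulfI ny); apply/eqP; rewrite -subr_eq0; apply/eqP.
have yE : p o1 = t * p o0 by rewrite -tE divfK.
move: on; rewrite yE => on.
transitivity ((p o0 * (t * p o0) * p o2 - p o0 ^+ 3 - (t * p o0) ^+ 3) +
   p o0 ^+ 3 * (1 - t ^+ 3)); first ring.
by rewrite on t3 subrr mulr0 addr0.
Qed.

Lemma hyperosc_nodal (w : C) p Q : w ^+ 3 = 1 -> same_pt (sext_pt w) p ->
  hyperosculating_conic N Q p -> exists c, c != 0 /\ Q = c *: osc_conic w.
Proof.
move=> w3 [l [nl pE]] [[hQ nQ] iQ].
have nw : w != 0 by apply: contra_eq_neq w3 => ->; rewrite expr0n eq_sym oner_eq0.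
have p0 : p o0 = l by rewrite pE /sext_pt /vec3 mulr1.
have p1 : p o1 = l * w by rewrite pE.
have nx : p o0 != 0 by rewrite p0.
have ny : p o1 != 0 by rewrite p1 mulf_neq0.
have [q hq] := branch_order hQ (isT : (1 < 6)%N) nx ny iQ.
rewrite (_ : p o1 / p o0 = w) in hq; last by rewrite p0 p1 mulrAC divff // mul1r.
have [a [b [c [d [e [f QE]]]]]] := homog2E hQ.
have [[_ h1 h2] [h3 h4 h5]] := conic_contact QE hq.
have w4 : w ^+ 4 = w by rewrite exprSr w3 mul1r.
have w5 : w ^+ 5 = w ^+ 2 by rewrite -[5%N]/(3 + 2)%N exprD w3 mul1r.
rewrite ?w3 ?w4 ?w5 in h1 h3 h4.
have aE : a = 21 * w * f by apply: (addIr e); rewrite h3 h2; ring.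
have bE : b = - 22 * f by apply: (addIr (2 * f)); rewrite h4; ring.
have cE : c = 21 * w ^+ 2 * f by apply: (addIr d); rewrite h5 h1; ring.
have {}QE : Q = f *: osc_conic w.
  rewrite QE aE bE cE h1 h2 -mul_mpolyC /osc_conic /conic.
  by rewrite !(mpolyC_nat, mpolyCN, rmorphXn, mpolyCM) /=; ring.
by exists f; split=> //; apply: contraNneq nQ => f0; rewrite QE f0 scale0r.
Qed.

Lemma sext_pt_sextactic (w : C) : w ^+ 3 = 1 -> sextactic_pt N (sext_pt w).
Proof.
move=> w3.
have nw : w != 0 by apply: contra_eq_neq w3 => ->; rewrite expr0n eq_sym oner_eq0.
have nx : sext_pt w o0 != 0 by rewrite oner_neq0.
have ny : sext_pt w o1 != 0 by [].
have tE : sext_pt w o1 / sext_pt w o0 = w by rewrite /sext_pt /vec3 /= divr1.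
have on : on_curve N (sext_pt w).
  rewrite /on_curve meval_nodal /nodal /sext_pt /vec3 /=.
  by transitivity (w ^+ 3 - 1); [ring | rewrite w3 subrr].
split.
  split; first by exists o0.
  split=> //; exists o2; case: grad_nodal => _ _ ->.
  by rewrite rmorphM /= !mevalXU mulf_neq0.
split.
  move=> [_ [L [[hL nL] iL]]].
  have [q hq] := branch_order hL (isT : (1 < 3)%N) nx ny iL; rewrite tE in hq.
  have [a [b [c LE]]] := homog1E hL.
  have [aE bE cE] := line_contact LE hq.
  have c0 : c = 0.
    move/eqP: cE; rewrite w3 mul1r -addr_eq0 -mulr2n -mulr_natl mulf_eq0 pnatr_eq0.
    by move/eqP.
  by case/negP: nL; rewrite LE aE bE c0 !mulr0 oppr0 mpolyC0 !mul0r !addr0.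
exists (osc_conic w); split; first by split; [exact: conic_homog | exact: osc_conic_neq0].
apply: (branch_param (conic_homog w) nx ny on); exists 1.
by rewrite tE compose_osc_conic.
Qed.

Lemma same_sext_pt (v w : C) : same_pt (sext_pt v) (sext_pt w) -> v = w.
Proof.
move=> [c [_ h]]; have := h o0; have := h o1; rewrite /sext_pt /vec3 /= mulr1.
by move=> -> <-; rewrite mul1r.
Qed.

End Sextactic.

(** * Regular elements and squarefree products *)

Section Divisibility.
Variable C : numClosedFieldType.
Local Notation S := {mpoly C[3]}.

Definition dvdS (d p : S) : Prop := exists q, p = d * q.

(** For [d] nonzero this means that [c] and [d] have no common factor; the cancellation form is the
    one that gets applied and can be proved without factorizations. *)
Definition regular_mod (d c : S) : Prop := forall w, dvdS d (c * w) -> dvdS d w.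

(* Over a field of characteristic 0, this holds iff f is squarefree. *)
Definition reduced (f : S) : Prop :=
  forall w, (forall i, dvdS f (f^`M(i) * w)) -> dvdS f w.

Lemma dvdS_lin d p q a b : dvdS d p -> dvdS d q -> dvdS d (a * p + b * q).
Proof. by move=> [u ->] [v ->]; exists (a * u + b * v); ring. Qed.

Lemma dvdS_mull d p : dvdS d (d * p). Proof. by exists p. Qed.

Definition linform (c : 'I_3 -> C) : S := \sum_j (c j)%:MP * 'X_j.

Lemma linform_neq0 c i : c i != 0 -> linform c != 0.
Proof.
move=> ci; apply: contraNneq ci => /(congr1 (meval (fun j => (i == j)%:R))).
rewrite meval0 rmorph_sum (bigD1 i) //= big1 => [|j /negbTE ji].
  by rewrite rmorphM /= mevalC mevalXU eqxx mulr1 addr0 => ->.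
by rewrite rmorphM /= mevalXU eq_sym ji mulr0.
Qed.

(* Modulo a linear form one variable can be eliminated, which leaves a domain. *)
Lemma linform_prime c i a b : c i != 0 -> dvdS (linform c) (a * b) ->
  dvdS (linform c) a \/ dvdS (linform c) b.
Proof.
move=> ci; set L := linform c.
pose u k : S := 'X_k - (if k == i then (c i)^-1%:MP * L else 0).
pose sub := mmap (@mpolyC 3 C) u.
have subE p : dvdS L (p - sub p).
  have id_p : mmap (@mpolyC 3 C) (fun k => 'X_k) p = p.
    rewrite -[RHS]comp_mpoly_id; congr (mmap _ _ _).
    by apply: funext => k; rewrite tnth_mktuple.
  rewrite -{1}id_p; apply: (@mmap_congr _ _ _ (@mpolyC 3 C : {rmorphism _ -> _})) => k.
  rewrite /u opprB addrC subrK; case: eqP => _; last by exists 0; rewrite mulr0.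
  by exists (c i)^-1%:MP; rewrite mulrC.
have subL : sub L = 0.
  rewrite /sub rmorph_sum; transitivity (\sum_j (c j)%:MP * u j).
    by apply: eq_bigr => j _; rewrite rmorphM /= mmapC mmap_U.
  rewrite /u; under eq_bigr do rewrite mulrBr.
  rewrite sumrB -/(linform c) -/L (bigD1 i) //= eqxx big1 => [|j /negbTE ->].
    by rewrite addr0 mulrA -mpolyCM mulfV // mul1r subrr.
  by rewrite mulr0.
have dvd0 p : sub p = 0 -> dvdS L p by move=> p0; have := subE p; rewrite p0 subr0.
case=> q /(congr1 sub); rewrite /sub !rmorphM /= -/sub subL mul0r => /eqP.
by rewrite mulf_eq0 => /orP[] /eqP /dvd0; [left | right].
Qed.

(** The point [v] shows that the linear form L does not divide [P]. If L w = P q, primality of L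
    puts L into q, and cancelling it exhibits w as a multiple of [P]. *)
Lemma linform_regular c i P v : c i != 0 -> (linform c).@[v] = 0 -> P.@[v] != 0 ->
  regular_mod P (linform c).
Proof.
move=> ci cv Pv w [q E].
have /(linform_prime ci) [[r Pr]|[r qr]] : dvdS (linform c) (P * q) by exists w.
  by move: Pv; rewrite Pr rmorphM /= cv mul0r eqxx.
exists r; apply: (mulfI (linform_neq0 ci)).
by rewrite E qr; ring.
Qed.

Lemma regular_modM d p q : regular_mod d p -> regular_mod d q -> regular_mod d (p * q).
Proof. by move=> hp hq w; rewrite -mulrA => /hp /hq. Qed.

Lemma regular_modX d p k : regular_mod d p -> regular_mod d (p ^+ k).
Proof.
move=> hp; elim: k => [|k IH] w; first by rewrite mul1r.
by rewrite exprS -mulrA => /hp /IH.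
Qed.

(** Modulo [d] the combination is [b * c], and a factor of a nonzerodivisor is a nonzerodivisor.
    This reduces coprimality of two curves to a combination that splits into lines. *)
Lemma regular_mod_comb d c a b : regular_mod d (a * d + b * c) -> regular_mod d c.
Proof.
move=> h w dw; apply: h.
rewrite (_ : _ * w = a * (d * w) + b * (c * w)); last ring.
by apply: dvdS_lin => //; exact: dvdS_mull.
Qed.

Definition coprimeS p q := regular_mod p q /\ regular_mod q p.

Lemma coprimeS_mul p q w : coprimeS p q -> dvdS p w -> dvdS q w -> dvdS (p * q) w.
Proof.
move=> [_ h] [u ->] /h [v ->]; exists v; ring.
Qed.

Lemma coprimeSM p q r : coprimeS p q -> coprimeS p r -> coprimeS q r ->
  coprimeS p (q * r).
Proof.
move=> [pq qp] [pr rp] qr; split; first exact: regular_modM.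
move=> w [v hv]; apply: coprimeS_mul => //; [apply: qp | apply: rp].
  by exists (r * v); rewrite hv mulrA.
by exists (q * v); rewrite hv; ring.
Qed.

(** By the product rule, modulo [p] the derivative of [p * q] is [q] times that of [p]; the factor
    [q] can be cancelled, and symmetrically for [q]. *)
Lemma reducedM p q : coprimeS p q -> reduced p -> reduced q -> reduced (p * q).
Proof.
move=> pq rp rq w hw; case: (pq) => pq1 pq2; apply: coprimeS_mul => //.
  apply: rp => i; have [u hu] := hw i; apply: pq1.
  exists (q * u - q^`M(i) * w); move: hu; rewrite mderivM => hu.
  by rewrite (_ : p * _ = p * q * u - p * q^`M(i) * w); [rewrite -hu; ring | ring].
apply: rq => i; have [u hu] := hw i; apply: pq2.
exists (p * u - p^`M(i) * w); move: hu; rewrite mderivM => hu.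
by rewrite (_ : q * _ = p * q * u - q * p^`M(i) * w); [rewrite -hu; ring | ring].
Qed.

End Divisibility.

(** * Exactness of the Koszul complex of the variables *)

Section Koszul.
Variable C : numClosedFieldType.
Local Notation S := {mpoly C[3]}.
Local Notation X := ('X_o0 : S).
Local Notation Y := ('X_o1 : S).
Local Notation Z := ('X_o2 : S).

Lemma linform_var i : linform (fun j => (i == j)%:R : C) = 'X_i.
Proof.
rewrite /linform (bigD1 i) //= eqxx mpolyC1 mul1r big1 ?addr0 // => j /negbTE ji.
by rewrite eq_sym ji mpolyC0 mul0r.
Qed.

Lemma dvdX_mul i (p q : S) : dvdS 'X_i (p * q) -> dvdS 'X_i p \/ dvdS 'X_i q.
Proof.
rewrite -linform_var; apply: (@linform_prime _ _ i).
by rewrite eqxx oner_neq0.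
Qed.

Lemma ndvdXX (i j : 'I_3) : i != j -> ~ dvdS 'X_i ('X_j : S).
Proof.
move=> ij [q /(congr1 (meval (fun k => (k == j)%:R)))]; rewrite rmorphM /= !mevalXU.
by rewrite eqxx (negbTE ij) mul0r => /eqP; rewrite oner_eq0.
Qed.

Lemma X_neq0 i : ('X_i : S) != 0.
Proof. by rewrite -linform_var; apply: (@linform_neq0 _ _ i); rewrite eqxx oner_neq0. Qed.

Lemma koszul2 i j (u v : S) : i != j -> 'X_i * u + 'X_j * v = 0 ->
  exists c, u = 'X_j * c /\ v = - ('X_i * c).
Proof.
move=> ij E; have : dvdS 'X_j ('X_i * u).
  by exists (- v); rewrite mulrN; apply/eqP; rewrite -addr_eq0 E.
case/dvdX_mul => [/ndvdXX|[c uE]]; first by rewrite eq_sym => /(_ ij).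
exists c; split=> //; apply: (mulfI (X_neq0 j)); apply/eqP.
rewrite -subr_eq0; apply/eqP; rewrite -[RHS]E uE; ring.
Qed.

(** Setting Z = 0 leaves a relation in X and Y, solved by [koszul2]. This determines [u] and [v] up
    to multiples of Z, after which Z cancels from the equation and gives [w]. *)
Lemma koszul3 (u v w : S) : X * u + Y * v + Z * w = 0 ->
  exists a b c, [/\ u = Y * c - Z * b, v = Z * a - X * c & w = X * b - Y * a].
Proof.
move=> E; pose h : 'I_3 -> S := vec3 X Y 0.
pose sub := mmap (@mpolyC 3 C) h.
have subE p : dvdS Z (p - sub p).
  have id_p : mmap (@mpolyC 3 C) (fun k => 'X_k) p = p.
    rewrite -[RHS]comp_mpoly_id; congr (mmap _ _ _).
    by apply: funext => k; rewrite tnth_mktuple.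
  rewrite -{1}id_p; apply: (@mmap_congr _ _ _ (@mpolyC 3 C : {rmorphism _ -> _})).
  elim/I3_ind; rewrite /h /vec3 /= ?subrr ?subr0; [exists 0|exists 0|exists 1];
    by rewrite ?mulr0 ?mulr1.
have E0 : X * sub u + Y * sub v = 0.
  have := congr1 sub E; rewrite /sub !rmorphD !rmorphM /= !mmap_U rmorph0.
  by rewrite /h /vec3 /= mul0r addr0.
have [//|c [uc vc]] := koszul2 (_ : o0 != o1) E0.
have [u' uE] := subE u; have [v' vE] := subE v.
have {}uE : u = Y * c + Z * u' by rewrite -uE -uc; ring.
have {}vE : v = - (X * c) + Z * v' by rewrite -vE -vc; ring.
exists v', (- u'), c; split; rewrite ?uE ?vE; [ring|ring|].
apply: (mulfI (X_neq0 o2)); apply/eqP; rewrite -subr_eq0; apply/eqP.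
by rewrite -[RHS]E uE vE; ring.
Qed.

End Koszul.

(** * The cubic and the conics are squarefree and pairwise coprime *)

Section ReducedArrangements.
Variable C : numClosedFieldType.
Local Notation S := {mpoly C[3]}.
Local Notation N := (nodal_cubic C).
Local Notation X := ('X_o0 : S).
Local Notation Y := ('X_o1 : S).
Local Notation Z := ('X_o2 : S).

Lemma X_regular i (P : S) v : v i = 0 -> P.@[v] != 0 -> regular_mod P 'X_i.
Proof.
move=> vi Pv; rewrite -linform_var; apply: (@linform_regular _ _ i _ v) => //.
  by rewrite eqxx oner_neq0.
by rewrite linform_var mevalXU.
Qed.

Lemma regular_mod_const (d : S) c : c != 0 -> regular_mod d c%:MP.
Proof.
move=> nc w [q E]; exists (c^-1%:MP * q).
by rewrite mulrCA -E mulrA -mpolyCM mulVf // mpolyC1 mul1r.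
Qed.

Lemma regular_mod_nat (d : S) k : regular_mod d k.+1%:R.
Proof. by rewrite -mpolyC_nat; apply: regular_mod_const; rewrite pnatr_eq0. Qed.

Lemma meval_conic w p : (osc_conic w).@[p] = conic w (p o0) (p o1) (p o2) :> C.
Proof. exact: (mmap_conic (@idfun C)). Qed.

(** The gradient ideal contains 3 X^3, namely Z times the last partial minus X times the first, and
    X does not divide [N], as the point (0, 1, 0) shows. *)
Lemma reduced_nodal : reduced N.
Proof.
move=> w hw; case: (grad_nodal C) => g0 _ g2.
have := dvdS_lin (- X) Z (hw o0) (hw o2); rewrite g0 g2 => h.
have N1 : N.@[vec3 0 1 0] != 0.
  rewrite meval_nodal /nodal /vec3 /= (_ : _ - _ = -1) ?oppr_eq0 ?oner_neq0 //.
  ring.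
apply: (regular_modX (k := 3) (X_regular (_ : vec3 0 1 0 o0 = 0) N1)) => //.
apply: (@regular_mod_nat _ 2).
by move: h; congr (dvdS _ _); ring.
Qed.

Lemma grad_conic w : let W := w%:MP : S in
  [/\ (osc_conic w)^`M(o0) = - 6 * W ^+ 2 * Z + 42 * W * X - 22 * Y,
      (osc_conic w)^`M(o1) = - 6 * W * Z + 42 * W ^+ 2 * Y - 22 * X
    & (osc_conic w)^`M(o2) = 2 * Z - 6 * W ^+ 2 * X - 6 * W * Y].
Proof.
rewrite /= /osc_conic /conic.
by split; rewrite !(mderiv_nat, mderiv_exp, mderivC, mderiv_X, mderivM, mderivB, mderivD)
  /=; ring.
Qed.

Lemma cubeC (w : C) : w ^+ 3 = 1 -> w%:MP ^+ 3 = 1 :> S.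
Proof. by move=> w3; rewrite -rmorphXn /= w3 mpolyC1. Qed.

Lemma reduced_conic (w : C) : w ^+ 3 = 1 -> reduced (osc_conic w).
Proof.
move=> w3 v hv; case: (grad_conic w) => /= g0 g1 g2; have W := cubeC w3.
have Q1 : (osc_conic w).@[vec3 0 0 1] != 0.
  rewrite meval_conic /conic /vec3 /= (_ : _ - _ = 1) ?oner_neq0 //; ring.
apply: (X_regular (_ : vec3 0 0 1 o0 = 0) Q1) => //.
(* The conic is smooth, so its partials are independent linear forms; the elimination below isolates
   1024 X, and [regular_mod_nat] takes the predecessor of 1024. *)
apply: (@regular_mod_nat _ 1023).
have := dvdS_lin (24 * w%:MP ^+ 2) 1 (dvdS_lin 1 (3 * w%:MP ^+ 2) (hv o0) (hv o2))
  (dvdS_lin 40 (120 * w%:MP) (hv o1) (hv o2)).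
rewrite g0 g1 g2 => /(dvdS_lin (-1) 0) /(_ (hv o0)).
congr (dvdS _ _).
transitivity (1024 * (X * v) + (w%:MP ^+ 3 - 1) *
  ((432 * w%:MP ^+ 3 + 144) * X + 432 * w%:MP ^+ 2 * Y) * v); first ring.
by rewrite W subrr !mul0r addr0.
Qed.

Lemma nodal_rescale (T : comNzRingType) (w x y z : T) : w ^+ 3 = 1 ->
  nodal (w ^+ 2 * x) (w * y) z = nodal x y z.
Proof.
move=> W; transitivity (w ^+ 3 * (x * y * z - y ^+ 3) - (w ^+ 3) ^+ 2 * x ^+ 3).
  by rewrite /nodal; ring.
by rewrite W /nodal; ring.
Qed.

Lemma conic_rescale (T : comNzRingType) (w x y z : T) : w ^+ 3 = 1 ->
  conic 1 (w ^+ 2 * x) (w * y) z = conic w x y z.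
Proof.
move=> W; transitivity (z ^+ 2 - 6 * w ^+ 2 * x * z - 6 * w * y * z
   + 21 * w * w ^+ 3 * x ^+ 2 + 21 * w ^+ 2 * y ^+ 2 - 22 * w ^+ 3 * x * y).
  by rewrite /conic; ring.
by rewrite W /conic; ring.
Qed.

(* The conic cuts the parametrized cubic in (t - w)^6, hence this identity modulo N. *)
Lemma nodal_conic_comb (T : comNzRingType) (w x y z : T) : w ^+ 3 = 1 ->
  exists a b, (w ^+ 2 * x - w * y) ^+ 6 = a * nodal x y z + b * conic w x y z.
Proof.
move=> W; rewrite -(nodal_rescale x y z W) -(conic_rescale x y z W).
move: (w ^+ 2 * x) (w * y) => {W}x' y'.
exists (- x' ^+ 3 + 6 * x' ^+ 2 * y' + 6 * x' * y' ^+ 2 - x' * y' * z - y' ^+ 3),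
  (x' ^+ 2 * y' ^+ 2).
by rewrite /nodal /conic; ring.
Qed.

Lemma cube_neq0 (w : C) : w ^+ 3 = 1 -> w != 0.
Proof. by apply: contra_eq_neq => ->; rewrite expr0n eq_sym oner_eq0. Qed.

Lemma coprime_nodal_conic w : w ^+ 3 = 1 -> coprimeS N (osc_conic w).
Proof.
move=> w3; have W := cubeC w3; have nw := cube_neq0 w3.
(* [c] is the line joining the node to the contact point [sext_pt w]; its sixth power lies in the
   ideal of the two curves. [v] is a point of this line on neither curve. *)
pose c : 'I_3 -> C := vec3 (w ^+ 2) (- w) 0; pose v : 'I_3 -> C := vec3 w (w ^+ 2) 0.
have c1 : c o1 != 0 by rewrite oppr_eq0.
have cv : (linform c).@[v] = 0.
  rewrite /linform sum_I3 !rmorphD !rmorphM /= !mevalXU !mevalC /c /v /vec3 /=; ring.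
have cE : linform c = w%:MP ^+ 2 * X - w%:MP * Y.
  rewrite /linform sum_I3 /c /vec3 /= rmorphXn mpolyCN mpolyC0; ring.
have [a [b ab]] := nodal_conic_comb X Y Z W; rewrite -cE in ab.
have Nv : N.@[v] = -2.
  rewrite meval_nodal /nodal /v /vec3 /=.
  by transitivity (- w ^+ 3 - (w ^+ 3) ^+ 2); [ring | rewrite w3; ring].
have Qv : (osc_conic w).@[v] = 20.
  rewrite meval_conic /conic /v /vec3 /=.
  by transitivity (21 * (w ^+ 3) ^+ 2 - w ^+ 3); [ring | rewrite w3; ring].
split; [apply: (@regular_mod_comb _ _ _ a b) | apply: (@regular_mod_comb _ _ _ b a)].
  rewrite -[_ + _]ab; apply: regular_modX; apply: (linform_regular c1 cv).
  by rewrite Nv oppr_eq0 pnatr_eq0.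
rewrite addrC -[_ + _]ab; apply: regular_modX; apply: (linform_regular c1 cv).
by rewrite Qv pnatr_eq0.
Qed.

Lemma cube_roots_sum (v w : C) : v ^+ 3 = 1 -> w ^+ 3 = 1 -> v != w ->
  v ^+ 2 + v * w + w ^+ 2 = 0.
Proof.
move=> v3 w3 vw; have : (v - w) * (v ^+ 2 + v * w + w ^+ 2) = 0.
  by transitivity (v ^+ 3 - w ^+ 3); [ring | rewrite v3 w3 subrr].
by move/eqP; rewrite mulf_eq0 subr_eq0 (negbTE vw) => /eqP.
Qed.

Lemma third_root (v w : C) : v ^+ 3 = 1 -> w ^+ 3 = 1 -> v != w ->
  (- (v + w)) ^+ 3 = 1.
Proof.
move=> v3 w3 /(cube_roots_sum v3 w3) E.
transitivity (v ^+ 3 + (v ^+ 2 + v * w + w ^+ 2) * (- 2 * v - w)); first ring.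
by rewrite E mul0r addr0.
Qed.

Lemma coprime_conics v w : v ^+ 3 = 1 -> w ^+ 3 = 1 -> v != w ->
  coprimeS (osc_conic v) (osc_conic w : S).
Proof.
suff h (a b : C) : a ^+ 3 = 1 -> b ^+ 3 = 1 -> a != b ->
  regular_mod (osc_conic a) (osc_conic b : S).
  by move=> v3 w3 vw; split; apply: h; rewrite // eq_sym.
move: a b => {}v {}w v3 w3 vw.
have E := cube_roots_sum v3 w3 vw; have u3 := third_root v3 w3 vw.
have [u uE] : exists u, u = - (v + w) by exists (- (v + w)).
rewrite -uE in u3; have nu := cube_neq0 u3.
(* The difference of the two conics is a degenerate member of their pencil: up to a constant it is
   the product of these two lines, which depend only on the third root [u]. The points (0, 0, 1) and
   (2, 0, -7u^2) lie on them and off the first conic. *)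
pose c1 : 'I_3 -> C := vec3 u (-1) 0; pose c2 : 'I_3 -> C := vec3 (7 * u ^+ 2) (7 * u) 2.
have c1E : linform c1 = u%:MP * X - Y.
  rewrite /linform sum_I3 /c1 /vec3 /= mpolyCN mpolyC0 mpolyC1; ring.
have c2E : linform c2 = 7 * u%:MP ^+ 2 * X + 7 * u%:MP * Y + 2 * Z.
  by rewrite /linform sum_I3 /c2 /vec3 /= !(rmorph_nat, rmorphXn, rmorphM) /=; ring.
apply: (@regular_mod_comb _ _ _ 1 (-1)).
have -> : 1 * osc_conic v + -1 * osc_conic w = (3 * (v - w))%:MP * (linform c1 * linform c2).
  rewrite c1E c2E; have U := cubeC u3.
  have -> : osc_conic v = conic v%:MP X Y Z by [].
  have -> : osc_conic w = conic w%:MP X Y Z by [].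
  rewrite /conic rmorphM rmorph_nat rmorphB /=.
  transitivity (3 * (v%:MP - w%:MP) * (2 * u%:MP * X * Z - 2 * Y * Z
    + 7 * X ^+ 2 - 7 * u%:MP * Y ^+ 2)).
    by rewrite uE mpolyCN mpolyCD; ring.
  congr (_ * _).
  transitivity (2 * u%:MP * X * Z - 2 * Y * Z
    + 7 * u%:MP ^+ 3 * X ^+ 2 - 7 * u%:MP * Y ^+ 2); last ring.
  by rewrite U; ring.
apply: regular_modM.
  by apply: regular_mod_const; rewrite mulf_neq0 ?pnatr_eq0 // subr_eq0.
have c1u : c1 o0 != 0 by [].
have c2u : c2 o2 != 0 by rewrite pnatr_eq0.
apply: regular_modM.
  apply: (linform_regular (v := vec3 0 0 1) c1u).
    rewrite c1E rmorphB rmorphM /= !mevalXU mevalC /vec3 /=; ring.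
  rewrite meval_conic /conic /vec3 /= (_ : _ - _ = 1) ?oner_neq0 //; ring.
apply: (linform_regular (v := vec3 2 0 (- 7 * u ^+ 2)) c2u).
  rewrite /linform sum_I3 !rmorphD !rmorphM /= !mevalXU !mevalC /c2 /vec3 /=; ring.
rewrite meval_conic /conic /vec3 /= (_ : _ - _ = - 35 * u).
  by rewrite mulf_neq0 // oppr_eq0 pnatr_eq0.
transitivity (49 * u ^+ 3 * u + 84 * (v ^+ 2 * u ^+ 2 + v)); first ring.
have uv : v * u = w ^+ 2.
  by transitivity (w ^+ 2 - (v ^+ 2 + v * w + w ^+ 2)); [rewrite uE; ring | rewrite E subr0].
rewrite -exprMn uv (_ : (w ^+ 2) ^+ 2 = w ^+ 3 * w); last ring.
by rewrite w3 u3 uE; ring.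
Qed.

End ReducedArrangements.

(** * Syzygies and cross products *)

Section CrossProducts.
Variable C : numClosedFieldType.
Local Notation S := {mpoly C[3]}.

Definition cross (u v : 'I_3 -> S) : 'I_3 -> S :=
  vec3 (u o1 * v o2 - u o2 * v o1) (u o2 * v o0 - u o0 * v o2)
       (u o0 * v o1 - u o1 * v o0).

(** For any vectors, det(X, a, b) G = (G.X)(a x b) + (G.a)(b x X) + (G.b)(X x a). With G the
    gradient, the last two terms vanish and Euler's formula evaluates G.X. *)
Lemma euler_cross (f : S) d a b l : f \is d.-homog -> syzygy f a -> syzygy f b ->
  f^`M(l) * \sum_i 'X_i * cross a b i = d%:R * f * cross a b l.
Proof.
move=> /euler_homog <-; rewrite /syzygy !sum_I3 => sa sb.
apply/eqP; rewrite -subr_eq0; apply/eqP.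
transitivity (
  (b o0 * f^`M(o0) + b o1 * f^`M(o1) + b o2 * f^`M(o2)) * cross (fun i => 'X_i) a l -
  (a o0 * f^`M(o0) + a o1 * f^`M(o1) + a o2 * f^`M(o2)) * cross (fun i => 'X_i) b l).
  by clear sa sb; elim/I3_ind: l; rewrite /cross /vec3 /=; ring.
by rewrite sa sb !mul0r subr0.
Qed.

Lemma cross_eq (f m : S) d a b l : f != 0 -> f \is d.+1.-homog ->
  syzygy f a -> syzygy f b ->
  \sum_i 'X_i * cross a b i = d.+1%:R * m * f -> cross a b l = m * f^`M(l).
Proof.
move=> nf hf sa sb E; have := euler_cross l hf sa sb; rewrite E => h.
apply: (mulfI nf); apply: (@natS_inj C d); rewrite mulrA -h; ring.
Qed.

(** This is where squarefreeness enters: by [euler_cross], [f] divides every partial times the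
    determinant of (X, a, b), hence divides the determinant itself. *)
Lemma cross_syz (f : S) d a b : f != 0 -> f \is d.+1.-homog -> reduced f ->
  syzygy f a -> syzygy f b -> exists h, forall l, cross a b l = h * f^`M(l).
Proof.
move=> nf hf rf sa sb.
have [|h hE] := rf (\sum_i 'X_i * cross a b i).
  move=> l; rewrite (euler_cross l hf sa sb); exists (d.+1%:R * cross a b l); ring.
exists ((d.+1%:R^-1)%:MP * h) => l; apply: (cross_eq l nf hf sa sb); rewrite hE.
have dK : d.+1%:R * (d.+1%:R^-1)%:MP = 1 :> S.
  by rewrite -mpolyC_nat -mpolyCM mulfV ?mpolyC1 // pnatr_eq0.
by rewrite mulrA dK mul1r mulrC.
Qed.

Lemma grad_neq0 (f : S) d : f != 0 -> f \is d.+1.-homog -> exists k, f^`M(k) != 0.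
Proof.
move=> nf hf; have [//|h] := pselect (exists k, f^`M(k) != 0).
case/negP: nf; rewrite -(inj_eq (@natS_inj C d)) -(euler_homog hf) mulr0.
by rewrite big1 // => i _; have [->|nz] := eqVneq f^`M(i) 0; rewrite ?mulr0 //;
  case: h; exists i.
Qed.

(* Three syzygies are orthogonal to the gradient, hence linearly dependent. *)
Lemma cross_coplanar (f : S) j a b c k l : f^`M(j) != 0 ->
  syzygy f a -> syzygy f b -> syzygy f c ->
  cross b c k * a l + cross c a k * b l + cross a b k * c l = 0.
Proof.
rewrite /syzygy !sum_I3 => nj sa sb sc.
pose det := a o0 * cross b c o0 + a o1 * cross b c o1 + a o2 * cross b c o2.
have det0 : det = 0.
  apply: (mulIf nj); rewrite mul0r.
  transitivity ((a o0 * f^`M(o0) + a o1 * f^`M(o1) + a o2 * f^`M(o2)) * cross b c j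
    + (b o0 * f^`M(o0) + b o1 * f^`M(o1) + b o2 * f^`M(o2)) * cross c a j
    + (c o0 * f^`M(o0) + c o1 * f^`M(o1) + c o2 * f^`M(o2)) * cross a b j).
    by rewrite /det; clear; elim/I3_ind: j; rewrite /cross /vec3 /=; ring.
  by rewrite sa sb sc !mul0r !addr0.
transitivity (if k == l then det else 0); last by rewrite det0; case: ifP.
rewrite /det; clear; elim/I3_ind: k; elim/I3_ind: l; rewrite /cross /vec3 /=; ring.
Qed.

(** Saito's criterion. Coplanarity of [a], [rho1], [rho2] reads c f_j a + u f_j rho1 + v f_j rho2 =
    0 for a nonzero partial f_j, which cancels; the constant [c] is invertible. *)
Lemma free_criterion (f : S) d d1 d2 rho1 rho2 c : f != 0 -> f \is d.+1.-homog ->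
  reduced f -> homog_syzygy f d1 rho1 -> homog_syzygy f d2 rho2 ->
  c != 0 -> \sum_i 'X_i * cross rho1 rho2 i = d.+1%:R * c%:MP * f ->
  free_curve f d1 d2.
Proof.
move=> nf hf rf h1 h2 nc E; exists rho1, rho2; split=> //; split=> //.
have [j nj] := grad_neq0 nf hf.
case: h1 h2 => s1 _ [s2 _].
have E12 l := cross_eq l nf hf s1 s2 E.
have cK : (c^-1)%:MP * c%:MP = 1 :> S by rewrite -mpolyCM mulVf // mpolyC1.
have nc' : c%:MP * f^`M(j) != 0 by rewrite mulf_neq0 // mpolyC_eq0.
split.
  move=> a sa; have [u uE] := cross_syz nf hf rf s2 sa.
  have [v vE] := cross_syz nf hf rf sa s1.
  exists (fun i : 'I_2 => if i == ord0 then - (c^-1)%:MP * u else - (c^-1)%:MP * v) => l.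
  rewrite !big_ord_recl big_ord0 /= addr0.
  apply: (mulfI nc'); apply/eqP; rewrite -subr_eq0; apply/eqP.
  have := cross_coplanar j l nj sa s1 s2; rewrite E12 uE vE => E0.
  rewrite -[RHS]E0; transitivity (c%:MP * f^`M(j) * a l
     + ((c^-1)%:MP * c%:MP) * (u * f^`M(j) * rho1 l + v * f^`M(j) * rho2 l)); first ring.
  by rewrite cK; ring.
move=> g1 g2 hz.
(* For independence, the relation is crossed with [rho2], respectively [rho1], which leaves one
   coefficient times a nonzero multiple of the gradient. *)
have z k : cross (fun i => g1 * rho1 i + g2 * rho2 i) rho2 k = g1 * cross rho1 rho2 k.
  by clear; elim/I3_ind: k; rewrite /cross /vec3 /=; ring.
have z' k : cross rho1 (fun i => g1 * rho1 i + g2 * rho2 i) k = g2 * cross rho1 rho2 k.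
  by clear; elim/I3_ind: k; rewrite /cross /vec3 /=; ring.
have c0 u k : cross (fun i => g1 * rho1 i + g2 * rho2 i) u k = 0.
  by elim/I3_ind: k; rewrite /cross /vec3 /= !hz; ring.
have c0' u k : cross u (fun i => g1 * rho1 i + g2 * rho2 i) k = 0.
  by elim/I3_ind: k; rewrite /cross /vec3 /= !hz; ring.
split; apply: (mulIf nc'); rewrite mul0r -E12; [rewrite -z | rewrite -z'] => //.
Qed.

End CrossProducts.

Lemma I4_ind (P : 'I_4 -> Prop) :
  P (@Ordinal 4 0 isT) -> P (@Ordinal 4 1 isT) -> P (@Ordinal 4 2 isT) ->
  P (@Ordinal 4 3 isT) -> forall i, P i.
Proof.
move=> P0 P1 P2 P3 [[|[|[|[|//]]]] lti].
- by rewrite (_ : Ordinal lti = @Ordinal 4 0 isT) //; apply: val_inj.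
- by rewrite (_ : Ordinal lti = @Ordinal 4 1 isT) //; apply: val_inj.
- by rewrite (_ : Ordinal lti = @Ordinal 4 2 isT) //; apply: val_inj.
- by rewrite (_ : Ordinal lti = @Ordinal 4 3 isT) //; apply: val_inj.
Qed.

Definition vec4 {T : Type} (a b c d : T) (i : 'I_4) : T :=
  match val i with 0%N => a | 1%N => b | 2%N => c | _ => d end.

Lemma sum_vec4 (V : nmodType) (F : 'I_4 -> V) :
  \sum_(j < 4) F j = F (@Ordinal 4 0 isT) + F (@Ordinal 4 1 isT) +
    F (@Ordinal 4 2 isT) + F (@Ordinal 4 3 isT).
Proof.
rewrite !big_ord_recl big_ord0 addr0 !addrA.
by congr (F _ + F _ + F _ + F _); apply: val_inj.
Qed.

(** * Four syzygies bound by two linear relations *)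

Section FourGenerators.
Variable C : numClosedFieldType.
Local Notation S := {mpoly C[3]}.
Local Notation x := ('X_o0 : S).
Local Notation y := ('X_o1 : S).
Local Notation z := ('X_o2 : S).

(** The exchange of x and y, acting also on the components, preserves the curves of degrees 5 and 7.
    The suffixes mark the eigenvectors: [_sym] is fixed and [_anti] changes sign. *)
Definition syz2_sym : 'I_3 -> S := vec3
  (8 * x ^+ 2 + 73 * x * y - 9 * x * z - 15 * y ^+ 2)
  (- 15 * x ^+ 2 + 73 * x * y + 8 * y ^+ 2 - 9 * y * z)
  (195 * x ^+ 2 - 90 * x * y - 57 * x * z + 195 * y ^+ 2 - 57 * y * z + 6 * z ^+ 2).

Definition syz2_anti : 'I_3 -> S := vec3
  (4 * x ^+ 2 + x * y + 5 * x * z - 15 * y ^+ 2)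
  (15 * x ^+ 2 - x * y - 4 * y ^+ 2 - 5 * y * z)
  (15 * x ^+ 2 + 9 * x * z - 15 * y ^+ 2 - 9 * y * z).

Definition syz3_sym : 'I_3 -> S := vec3
  (4 * x ^+ 3 - 187 * x ^+ 2 * y + 47 * x ^+ 2 * z - 31 * x * y ^+ 2
   - 44 * x * y * z + 5 * x * z ^+ 2 + 147 * y ^+ 3 + 7 * y ^+ 2 * z)
  (147 * x ^+ 3 - 31 * x ^+ 2 * y + 7 * x ^+ 2 * z - 187 * x * y ^+ 2
   - 44 * x * y * z + 4 * y ^+ 3 + 47 * y ^+ 2 * z + 5 * y * z ^+ 2)
  (- 637 * x ^+ 3 + 336 * x ^+ 2 * y - 87 * x ^+ 2 * z + 336 * x * y ^+ 2
   + 492 * x * y * z - 9 * x * z ^+ 2 - 637 * y ^+ 3 - 87 * y ^+ 2 * z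
   - 9 * y * z ^+ 2 - 2 * z ^+ 3).

Definition syz3_anti : 'I_3 -> S := vec3
  (120 * x ^+ 3 + 637 * x ^+ 2 * y - 399 * x ^+ 2 * z + 1833 * x * y ^+ 2
   - 420 * x * y * z - 91 * x * z ^+ 2 + 1323 * y ^+ 3 + 273 * y ^+ 2 * z)
  (- 1323 * x ^+ 3 - 1833 * x ^+ 2 * y - 273 * x ^+ 2 * z - 637 * x * y ^+ 2
   + 420 * x * y * z - 120 * y ^+ 3 + 399 * y ^+ 2 * z + 91 * y * z ^+ 2)
  (1911 * x ^+ 3 + 1890 * x ^+ 2 * y + 939 * x ^+ 2 * z - 1890 * x * y ^+ 2
   + 105 * x * z ^+ 2 - 1911 * y ^+ 3 - 939 * y ^+ 2 * z - 105 * y * z ^+ 2).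

(** The exchange of x and y turns [syz5_s] into [syz5_t] and [syz5_p] into the opposite of [syz5_q].
    Under diag(w^2, w, 1) the first two are invariant as derivations, and the other two belong to
    the two nontrivial characters. *)
Definition syz5_s : 'I_3 -> S := vec3
  (- 4095 * x ^+ 3 * y ^+ 2 - 237 * x ^+ 2 * y * z ^+ 2 + 3606 * x * y ^+ 3 * z
   + 3 * x * z ^+ 4 - 3969 * y ^+ 5 - 24 * y ^+ 2 * z ^+ 3)
  (- 1302 * x ^+ 3 * y * z - 238 * x ^+ 2 * y ^+ 3 + 15 * x ^+ 2 * z ^+ 3
   + 842 * x * y ^+ 2 * z ^+ 2 - 1215 * y ^+ 4 * z - 10 * y * z ^+ 4)
  (- (273 * 49) * x ^+ 4 * y + 273 * x ^+ 3 * z ^+ 2 + (41 * 293) * x ^+ 2 * y ^+ 2 * z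
   - (21 * 653) * x * y ^+ 4 - 314 * x * y * z ^+ 3 + 141 * y ^+ 3 * z ^+ 2 + z ^+ 5).

Definition syz5_t : 'I_3 -> S := vec3
  (- 1215 * x ^+ 4 * z - 238 * x ^+ 3 * y ^+ 2 + 842 * x ^+ 2 * y * z ^+ 2
   - 1302 * x * y ^+ 3 * z - 10 * x * z ^+ 4 + 15 * y ^+ 2 * z ^+ 3)
  (- 3969 * x ^+ 5 + 3606 * x ^+ 3 * y * z - 4095 * x ^+ 2 * y ^+ 3
   - 24 * x ^+ 2 * z ^+ 3 - 237 * x * y ^+ 2 * z ^+ 2 + 3 * y * z ^+ 4)
  (- (21 * 653) * x ^+ 4 * y + 141 * x ^+ 3 * z ^+ 2 + (41 * 293) * x ^+ 2 * y ^+ 2 * z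
   - (273 * 49) * x * y ^+ 4 - 314 * x * y * z ^+ 3 + 273 * y ^+ 3 * z ^+ 2 + z ^+ 5).

Definition syz5_p : 'I_3 -> S := vec3
  (90 * x ^+ 3 * y * z + 34 * x ^+ 2 * y ^+ 3 - 3 * x ^+ 2 * z ^+ 3
   - 46 * x * y ^+ 2 * z ^+ 2 + 105 * y ^+ 4 * z)
  (567 * x ^+ 4 * y - 15 * x ^+ 3 * z ^+ 2 - 520 * x ^+ 2 * y ^+ 2 * z
   + 585 * x * y ^+ 4 + 10 * x * y * z ^+ 3 + 21 * y ^+ 3 * z ^+ 2)
  (- 273 * x ^+ 4 * z + 1959 * x ^+ 3 * y ^+ 2 + 265 * x ^+ 2 * y * z ^+ 2
   - 1996 * x * y ^+ 3 * z - x * z ^+ 4 + 1911 * y ^+ 5 + 7 * y ^+ 2 * z ^+ 3).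

Definition syz5_q : 'I_3 -> S := vec3
  (- 585 * x ^+ 4 * y - 21 * x ^+ 3 * z ^+ 2 + 520 * x ^+ 2 * y ^+ 2 * z
   - 567 * x * y ^+ 4 - 10 * x * y * z ^+ 3 + 15 * y ^+ 3 * z ^+ 2)
  (- 105 * x ^+ 4 * z - 34 * x ^+ 3 * y ^+ 2 + 46 * x ^+ 2 * y * z ^+ 2
   - 90 * x * y ^+ 3 * z + 3 * y ^+ 2 * z ^+ 3)
  (- 1911 * x ^+ 5 + 1996 * x ^+ 3 * y * z - 1959 * x ^+ 2 * y ^+ 3
   - 7 * x ^+ 2 * z ^+ 3 - 265 * x * y ^+ 2 * z ^+ 2 + 273 * y ^+ 4 * z + y * z ^+ 4).


(* The coefficients are those of the Buchsbaum-Rim complex of the 2 x 4 matrix of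
   linear relations between the four generators. *)
Lemma linear_relations_solve (hs ht hp hq : S) :
  x * hs + z * hp - 7 * y * hq = 0 -> y * ht + 7 * x * hp - z * hq = 0 ->
  exists gs gt gp gq,
    49 * hp = - 7 * y ^+ 2 * gs - x * z * gt - x * y * gq /\
    49 * hq = - y * z * gs - 7 * x ^+ 2 * gt + x * y * gp.
Proof.
move=> E1 E2.
have [|a [b [c [e1 e2 e3]]]] := @koszul3 C hs (- 7 * hq) hp.
  by rewrite -[RHS]E1; ring.
(* Multiplying [E2] by 7 lets the solution of [E1] be inserted, which gives again a relation among
   x, y, z. The next two calls treat the equations [e6] and [e4] that result. *)
have [|a2 [b2 [c2 [e4 e5 e6]]]] :=
    @koszul3 C (49 * x * b - z * c) (7 * ht - 49 * x * a) (z * a).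
  transitivity (7 * (y * ht + 7 * x * hp - z * hq)); last by rewrite E2 mulr0.
  transitivity (7 * y * ht + 49 * x * hp + z * (- 7 * hq)); last ring.
  by rewrite e2 e3; ring.
have [|a3 [b3 [c3 [e7 e8 e9]]]] := @koszul3 C b2 (- a2) (- a).
  by apply/eqP; rewrite mulrN mulrN subr_eq0 e6; apply/eqP; ring.
have [|a4 [b4 [c4 [e10 e11 e12]]]] := @koszul3 C (49 * b) (- c2) (b2 - c).
  transitivity (49 * x * b - z * c - (y * c2 - z * b2)); first ring.
  by rewrite e4 subrr.
exists (7 * a3), b4, (7 * (c3 + a4)), (- (c4 + 49 * b3)).
have aE : a = y * a3 - x * b3 by rewrite -[LHS]opprK e9; ring.
have cE : c = y * c3 - z * b3 - x * b4 + y * a4 by rewrite -e7 -[LHS](subKr b2) e12; ring.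
split; first by rewrite e3 aE mulrBr mulrCA e10; ring.
by transitivity (- 7 * (- 7 * hq)); [ring | rewrite e2 aE cE; ring].
Qed.

Lemma crossC (u v : 'I_3 -> S) l : cross u v l = - cross v u l.
Proof. by elim/I3_ind: l; rewrite /cross /vec3 /=; ring. Qed.

Lemma cross_self (u : 'I_3 -> S) l : cross u u l = 0.
Proof. by elim/I3_ind: l; rewrite /cross /vec3 /=; ring. Qed.

(** The relation matrix has rows (x, 0, z, -7y) and (0, y, 7x, -z). Up to sign, each listed cross
    product is 13 times the complementary 2 x 2 minor times the gradient. The multipliers of
    [cross a s], ..., [cross a q] inherit the two relations. *)
Lemma four_generators (f : S) d (s t p q : 'I_3 -> S) :
  f != 0 -> f \is d.+1.-homog -> reduced f ->
  syzygy f s -> syzygy f t -> syzygy f p -> syzygy f q ->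
  (forall l, x * s l + z * p l - 7 * y * q l = 0) ->
  (forall l, y * t l + 7 * x * p l - z * q l = 0) ->
  (forall l, cross s p l = - 91 * y ^+ 2 * f^`M(l)) ->
  (forall l, cross s q l = - 13 * y * z * f^`M(l)) ->
  (forall l, cross t p l = - 13 * x * z * f^`M(l)) ->
  (forall l, cross t q l = - 91 * x ^+ 2 * f^`M(l)) ->
  (forall l, cross p q l = 13 * x * y * f^`M(l)) ->
  generates_AR f (vec4 s t p q).
Proof.
move=> nf hf rf ss st sp sq r1 r2 msp msq mtp mtq mpq a sa.
have [j nj] := grad_neq0 nf hf.
have [hs hsE] := cross_syz nf hf rf sa ss.
have [ht htE] := cross_syz nf hf rf sa st.
have [hp hpE] := cross_syz nf hf rf sa sp.
have [hq hqE] := cross_syz nf hf rf sa sq.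
have [||gs [gt [gp [gq [e1 e2]]]]] := @linear_relations_solve hs ht hp hq.
- apply: (mulIf nj); rewrite mul0r.
  transitivity (cross a (fun l => x * s l + z * p l - 7 * y * q l) j).
    transitivity (x * cross a s j + z * cross a p j - 7 * y * cross a q j).
      by rewrite hsE hpE hqE; ring.
    by move: (j); elim/I3_ind; rewrite /cross /vec3 /=; ring.
  by move: (j); elim/I3_ind; rewrite /cross /vec3 /= !r1; ring.
- apply: (mulIf nj); rewrite mul0r.
  transitivity (cross a (fun l => y * t l + 7 * x * p l - z * q l) j).
    transitivity (y * cross a t j + 7 * x * cross a p j - z * cross a q j).
      by rewrite htE hpE hqE; ring.
    by move: (j); elim/I3_ind; rewrite /cross /vec3 /=; ring.
  by move: (j); elim/I3_ind; rewrite /cross /vec3 /= !r2; ring.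
(* 637 = 13 * 49, with 13 from the cross products and 49 from [linear_relations_solve]. The
   coefficients make the error [D] cross to zero with [p] and [q]; as [cross p q] is nonzero,
   coplanarity yields [D = 0]. *)
pose D l := 637 * a l - (gs * s l + gt * t l + gp * p l + gq * q l).
have DE v k : cross D v k = 637 * cross a v k - (gs * cross s v k + gt * cross t v k
    + gp * cross p v k + gq * cross q v k).
  by rewrite /D; move: (k); elim/I3_ind; rewrite /cross /vec3 /=; ring.
have Dp k : cross D p k = 0.
  rewrite DE hpE msp mtp cross_self (crossC q p) mpq.
  transitivity (13 * (49 * hp) * f^`M(k) - (gs * (- 91 * y ^+ 2 * f^`M(k))
    + gt * (- 13 * x * z * f^`M(k)) + gq * (- (13 * x * y * f^`M(k))))); first ring.
  by rewrite e1; ring.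
have Dq k : cross D q k = 0.
  rewrite DE hqE msq mtq cross_self mpq.
  transitivity (13 * (49 * hq) * f^`M(k) - (gs * (- 13 * y * z * f^`M(k))
    + gt * (- 91 * x ^+ 2 * f^`M(k)) + gp * (13 * x * y * f^`M(k)))); first ring.
  by rewrite e2; ring.
have sD : syzygy f D.
  rewrite /syzygy; transitivity (637 * (\sum_i a i * f^`M(i)) -
    (gs * (\sum_i s i * f^`M(i)) + gt * (\sum_i t i * f^`M(i))
    + gp * (\sum_i p i * f^`M(i)) + gq * (\sum_i q i * f^`M(i)))).
    by rewrite !sum_I3 /D; ring.
  by rewrite sa ss st sp sq; ring.
have D0 l : D l = 0.
  have := cross_coplanar j l nj sD sp sq; rewrite Dp (crossC q D) Dq mpq.
  rewrite oppr0 !mul0r !addr0 => /eqP; rewrite !mulf_eq0 (negbTE nj).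
  rewrite (negbTE (X_neq0 _ _)) (negbTE (X_neq0 _ _)) (negbTE (natS_neq0 C 12)) /=.
  by move/eqP.
exists (vec4 ((637^-1)%:MP * gs) ((637^-1)%:MP * gt) ((637^-1)%:MP * gp)
  ((637^-1)%:MP * gq)) => l.
rewrite sum_vec4 /vec4 /=; apply: (@natS_inj C 636); apply/eqP.
rewrite -subr_eq0; apply/eqP; rewrite -[RHS](D0 l) /D.
have k1 : 637 * (637^-1)%:MP = 1 :> S.
  by rewrite -[X in X * _]mpolyC_nat -mpolyCM mulfV ?mpolyC1 // pnatr_eq0.
congr (_ - _); rewrite -!mulrA -!mulrDr mulrA k1 mul1r; ring.
Qed.

Lemma cross_comb (u v1 v2 v3 w : 'I_3 -> S) a b c l :
  (forall i, u i = a * v1 i + b * v2 i + c * v3 i) ->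
  cross u w l = a * cross v1 w l + b * cross v2 w l + c * cross v3 w l.
Proof. by move=> h; elim/I3_ind: l; rewrite /cross /vec3 /= !h; ring. Qed.

(** The variable ['X_i] must divide [w]. After cancelling it, ['X_i] divides ['X_k * v - 1] for some
    [v], which is impossible at the origin. *)
Lemma mixed_term_contra i j k (u w : S) : i != j -> i != k ->
  'X_i * ('X_j + 'X_i * u) <> 'X_j * 'X_k * w.
Proof.
move=> ij ik E; have /dvdX_mul [/dvdX_mul [/ndvdXX|/ndvdXX]|[v wE]] : dvdS 'X_i ('X_j * 'X_k * w).
- by exists ('X_j + 'X_i * u).
- exact.
- exact.
have {}E : 'X_j * ('X_k * v - 1) = 'X_i * u.
  apply: (mulfI (X_neq0 C i)); apply/eqP; rewrite -subr_eq0; apply/eqP.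
  transitivity ('X_j * 'X_k * ('X_i * v) - 'X_i * ('X_j + 'X_i * u)); first ring.
  by rewrite -wE E subrr.
have /dvdX_mul [/ndvdXX|[l lE]] : dvdS 'X_i ('X_j * ('X_k * v - 1)) by exists u.
  exact.
have /eqP := congr1 (meval (fun=> 0)) lE.
by rewrite mevalB !mevalM !mevalXU meval1 !mul0r sub0r oppr_eq0 oner_eq0.
Qed.

(** Crossing an expression of one generator by the others with [p] or [q] would put yz in (x), xz in
    (y), xy in (x^2, yz) or xy in (y^2, xz), according to the generator. *)
Lemma four_generators_minimal (f : S) k (s t p q : 'I_3 -> S) : f^`M(k) != 0 ->
  (forall l, cross s p l = - 91 * y ^+ 2 * f^`M(l)) ->
  (forall l, cross s q l = - 13 * y * z * f^`M(l)) ->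
  (forall l, cross t p l = - 13 * x * z * f^`M(l)) ->
  (forall l, cross t q l = - 91 * x ^+ 2 * f^`M(l)) ->
  (forall l, cross p q l = 13 * x * y * f^`M(l)) ->
  forall j0 : 'I_4, ~ exists g : 'I_4 -> S, forall i,
    vec4 s t p q j0 i = \sum_(j < 4 | j != j0) g j * vec4 s t p q j i.
Proof.
move=> nk msp msq mtp mtq mpq j0 [g hg].
have {hg} h l : vec4 s t p q j0 l =
    \sum_(j < 4) (if j != j0 then g j * vec4 s t p q j l else 0).
  by rewrite hg big_mkcond.
pose g0 := g (@Ordinal 4 0 isT); pose g1 := g (@Ordinal 4 1 isT).
pose g2 := g (@Ordinal 4 2 isT); pose g3 := g (@Ordinal 4 3 isT).
have cancel13 (a b : S) : 13 * a * f^`M(k) = 13 * b * f^`M(k) -> a = b.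
  by move=> /(mulIf nk) /(@natS_inj C 12).
elim/I4_ind: j0 h => h.
- have hs i : s i = g1 * t i + g2 * p i + g3 * q i by rewrite [LHS]h sum_vec4 /= add0r.
  have := cross_comb q k hs; rewrite msq mtq mpq cross_self => E.
  have /(congr1 (meval (vec3 0 1 1))) : - (y * z) = x * (- 7 * x * g1 + y * g2).
    by apply: cancel13; transitivity (- 13 * y * z * f^`M(k)); [ring | rewrite E; ring].
  rewrite mevalN !mevalM !mevalXU /vec3 /= mul0r mulr1 => /eqP.
  by rewrite oppr_eq0 oner_eq0.
- have ht i : t i = g0 * s i + g2 * p i + g3 * q i by rewrite [LHS]h sum_vec4 /= addr0.
  have := cross_comb p k ht; rewrite mtp msp (crossC q p) mpq cross_self => E.
  have /(congr1 (meval (vec3 1 0 1))) : - (x * z) = y * (- 7 * y * g0 - x * g3).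
    by apply: cancel13; transitivity (- 13 * x * z * f^`M(k)); [ring | rewrite E; ring].
  rewrite mevalN !mevalM !mevalXU /vec3 /= mul0r mulr1 => /eqP.
  by rewrite oppr_eq0 oner_eq0.
- have hp i : p i = g0 * s i + g1 * t i + g3 * q i by rewrite [LHS]h sum_vec4 /= addr0.
  have := cross_comb q k hp; rewrite mpq msq mtq cross_self => E.
  apply: (@mixed_term_contra o0 o1 o2 (7 * g1) (- g0)) => //; apply: cancel13.
  transitivity (13 * x * y * f^`M(k) + 91 * x ^+ 2 * g1 * f^`M(k)); first ring.
  by rewrite E; ring.
have hq i : q i = g0 * s i + g1 * t i + g2 * p i by rewrite [LHS]h sum_vec4 /= addr0.
have := cross_comb p k hq; rewrite (crossC q p) mpq msp mtp cross_self => E.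
apply: (@mixed_term_contra o1 o0 o2 (- 7 * g0) g1) => //; apply: cancel13.
transitivity (- (- (13 * x * y * f^`M(k))) - 91 * y ^+ 2 * g0 * f^`M(k)); first ring.
by rewrite E; ring.
Qed.

End FourGenerators.

(** * The arrangements of degree 5, 7 and 9 *)

Section NormalForms.
Variable C : numClosedFieldType.
Local Notation S := {mpoly C[3]}.
Local Notation N := (nodal_cubic C).
Local Notation x := ('X_o0 : S).
Local Notation y := ('X_o1 : S).
Local Notation z := ('X_o2 : S).

Definition conicA (T : comNzRingType) (x y z : T) : T := z ^+ 2 - 22 * x * y.
Definition conicB (T : comNzRingType) (x y z : T) : T := 21 * x ^+ 2 - 6 * y * z.
Definition conicC (T : comNzRingType) (x y z : T) : T := 21 * y ^+ 2 - 6 * x * z.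

(* [conic w] is A + w B + w^2 C; the products over two or three distinct cube roots of
   unity are partial norms, in which only the missing root u remains. *)
Definition two_conics (T : comNzRingType) (u x y z : T) : T :=
  let a := conicA x y z in let b := conicB x y z in let c := conicC x y z in
  a ^+ 2 + u ^+ 2 * b ^+ 2 + u * c ^+ 2 - u * a * b - u ^+ 2 * a * c - b * c.

Definition three_conics (T : comNzRingType) (x y z : T) : T :=
  let a := conicA x y z in let b := conicB x y z in let c := conicC x y z in
  a ^+ 3 + b ^+ 3 + c ^+ 3 - 3 * a * b * c.

(** The quadratic relation is assumed in place of [v != w] because [T] need not be a domain, where
    distinct cube roots of 1 could violate it. *)
Lemma two_conicsE (T : comNzRingType) (v w x y z : T) :
  v ^+ 3 = 1 -> w ^+ 3 = 1 -> v ^+ 2 + v * w + w ^+ 2 = 0 ->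
  conic v x y z * conic w x y z = two_conics (- (v + w)) x y z.
Proof.
move=> v3 w3 E; rewrite /two_conics.
pose a := conicA x y z; pose b := conicB x y z; pose c := conicC x y z.
transitivity ((a + v * b + v ^+ 2 * c) * (a + w * b + w ^+ 2 * c)).
  by rewrite /conic /a /b /c /conicA /conicB /conicC; ring.
rewrite -/a -/b -/c; move: a b c => a b c.
apply/eqP; rewrite -subr_eq0; apply/eqP.
transitivity ((v ^+ 2 + v * w + w ^+ 2) * (2 * a * c - b ^+ 2 + v * b * c + v * w * c ^+ 2)
  + (1 - v ^+ 3) * (b * c + w * c ^+ 2) + (1 - w ^+ 3) * (v * c ^+ 2)); first ring.
by rewrite E v3 w3; ring.
Qed.

Lemma two_conics_cube (T : comNzRingType) (u x y z : T) : u ^+ 3 = 1 ->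
  let a := conicA x y z in let b := u * conicB x y z in let c := u ^+ 2 * conicC x y z in
  two_conics u x y z = a ^+ 2 + b ^+ 2 + c ^+ 2 - a * b - a * c - b * c.
Proof.
move=> u3 /=; rewrite /two_conics; move: (conicA _ _ _) (conicB _ _ _) (conicC _ _ _).
move=> a b c; transitivity (a ^+ 2 + u ^+ 2 * b ^+ 2 + u ^+ 3 * u * c ^+ 2 - u * a * b
  - u ^+ 2 * a * c - u ^+ 3 * b * c); last ring.
by rewrite u3; ring.
Qed.

Lemma three_conicsE (T : comNzRingType) (u x y z : T) : u ^+ 3 = 1 ->
  conic u x y z * two_conics u x y z = three_conics x y z.
Proof.
move=> u3; rewrite two_conics_cube // /three_conics.
pose a := conicA x y z; pose b := conicB x y z; pose c := conicC x y z.
transitivity ((a + u * b + u ^+ 2 * c) * (a ^+ 2 + (u * b) ^+ 2 + (u ^+ 2 * c) ^+ 2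
    - a * (u * b) - a * (u ^+ 2 * c) - u * b * (u ^+ 2 * c))).
  by rewrite /conic /a /b /c /conicA /conicB /conicC; ring.
rewrite -/a -/b -/c; move: a b c => a b c.
transitivity (a ^+ 3 + u ^+ 3 * b ^+ 3 + (u ^+ 3) ^+ 2 * c ^+ 3 - 3 * a * b * u ^+ 3 * c).
  ring.
by rewrite u3; ring.
Qed.

Lemma two_conics_rescale (T : comNzRingType) (u x y z : T) : u ^+ 3 = 1 ->
  two_conics 1 (u ^+ 2 * x) (u * y) z = two_conics u x y z.
Proof.
move=> u3; rewrite (two_conics_cube x y z u3) /two_conics.
have -> : conicA (u ^+ 2 * x) (u * y) z = conicA x y z.
  by transitivity (z ^+ 2 - 22 * u ^+ 3 * x * y); [rewrite /conicA|rewrite u3 /conicA]; ring.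
have -> : conicB (u ^+ 2 * x) (u * y) z = u * conicB x y z.
  transitivity (21 * u ^+ 3 * u * x ^+ 2 - 6 * u * y * z); first by rewrite /conicB; ring.
  by rewrite u3 /conicB; ring.
have -> : conicC (u ^+ 2 * x) (u * y) z = u ^+ 2 * conicC x y z.
  by rewrite /conicC; ring.
ring.
Qed.

Definition curve5 : S := N * osc_conic 1.
Definition curve7 : S := N * two_conics 1 x y z.
Definition curve9 : S := N * three_conics x y z.

Lemma exists_omega : exists w : C, w ^+ 3 = 1 /\ w ^+ 2 + w + 1 = 0.
Proof.
have /closed_rootP [w] : size (Poly [:: 1; 1; 1] : {poly C}) != 1%N.
  by rewrite (@PolyK _ 0) //= oner_neq0.
rewrite rootE horner_Poly /= mul0r add0r mulrDl mul1r => /eqP h.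
exists w; have E : w ^+ 2 + w + 1 = 0 by rewrite -[RHS]h; ring.
split=> //; transitivity ((w - 1) * (w ^+ 2 + w + 1) + 1); first ring.
by rewrite E mulr0 add0r.
Qed.

Lemma two_conics_factor : exists w w' : C,
  [/\ w ^+ 3 = 1, w' ^+ 3 = 1, w != w', 1 != w & 1 != w'] /\
  two_conics 1 x y z = osc_conic w * osc_conic w' :> S.
Proof.
have [w [w3 E]] := exists_omega; exists w, (w ^+ 2).
have nw := cube_neq0 w3.
have n1 : 1 != w.
  apply/eqP => w1; move: E; rewrite -w1 expr1n => /eqP.
  by rewrite (_ : 1 + 1 + 1 = 3) ?pnatr_eq0 //; ring.
have w6 : (w ^+ 2) ^+ 3 = 1 by rewrite -exprM mulnC exprM w3 expr1n.
have w2 : w ^+ 2 = - (w + 1) by apply/eqP; rewrite -addr_eq0 addrA E.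
split.
  split=> //.
    by rewrite expr2 -{1}[w]mulr1 (inj_eq (mulfI nw)).
  apply: contraNneq n1 => h; rewrite eq_sym; apply/eqP.
  by rewrite -w3 exprSr -h mul1r.
rewrite -[RHS]/(conic w%:MP x y z * conic (w ^+ 2)%:MP x y z).
have h : w%:MP ^+ 2 + w%:MP * (w ^+ 2)%:MP + (w ^+ 2)%:MP ^+ 2 = 0 :> S.
  rewrite -!rmorphXn -rmorphM -!rmorphD /= -[RHS]mpolyC0; congr (_%:MP).
  transitivity (w ^+ 2 + w ^+ 3 + w ^+ 3 * w); first ring.
  by rewrite w3 -[RHS]E; ring.
rewrite (two_conicsE x y z (cubeC w3) (cubeC w6) h) -mpolyCD -mpolyCN.
rewrite (_ : - (w + w ^+ 2) = 1) ?mpolyC1 //.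
by rewrite w2; ring.
Qed.

Lemma conic1_nodal_coprime : coprimeS N (osc_conic 1).
Proof. by apply: coprime_nodal_conic; rewrite expr1n. Qed.

Lemma reduced_curve5 : reduced curve5.
Proof.
apply: reducedM; [exact: conic1_nodal_coprime | exact: reduced_nodal|].
by apply: reduced_conic; rewrite expr1n.
Qed.

Lemma reduced_curve7 : reduced curve7.
Proof.
rewrite /curve7; have [w [w' [[w3 w3' ww _ _] ->]]] := two_conics_factor.
have cp := coprime_conics w3 w3' ww.
have cpN := coprimeSM (coprime_nodal_conic w3) (coprime_nodal_conic w3') cp.
exact: (reducedM cpN (@reduced_nodal C)
  (reducedM cp (reduced_conic w3) (reduced_conic w3'))).
Qed.

Lemma reduced_curve9 : reduced curve9.
Proof.
have o3 : 1 ^+ 3 = 1 :> C by rewrite expr1n.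
rewrite /curve9 -(@three_conicsE _ 1) ?expr1n //.
have [w [w' [[w3 w3' ww w1 w1'] ->]]] := two_conics_factor.
have cp := coprime_conics w3 w3' ww.
rewrite (_ : conic 1 x y z = osc_conic 1); last by rewrite /osc_conic mpolyC1.
have c1w := coprime_conics o3 w3 w1; have c1w' := coprime_conics o3 w3' w1'.
have cp1 := coprimeSM c1w c1w' cp.
have cpN := coprimeSM (coprime_nodal_conic w3) (coprime_nodal_conic w3') cp.
have rp := reducedM cp (reduced_conic w3) (reduced_conic w3').
exact: (reducedM (coprimeSM conic1_nodal_coprime cpN cp1) (@reduced_nodal C)
  (reducedM cp1 (reduced_conic o3) rp)).
Qed.

End NormalForms.

(** * Verification of the explicit syzygies and cross products *)

Section ExplicitSyzygies.
Variable C : numClosedFieldType.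
Local Notation S := {mpoly C[3]}.
Local Notation N := (nodal_cubic C).
Local Notation x := ('X_o0 : S).
Local Notation y := ('X_o1 : S).
Local Notation z := ('X_o2 : S).

Lemma homogM d d1 d2 (p q : S) : p \is d1.-homog -> q \is d2.-homog ->
  d = (d1 + d2)%N -> p * q \is d.-homog.
Proof. by move=> hp hq ->; exact: dhomogM. Qed.

Lemma homogB d (p q : S) : p \is d.-homog -> q \is d.-homog -> p - q \is d.-homog.
Proof. exact: rpredB. Qed.

Lemma homogD d (p q : S) : p \is d.-homog -> q \is d.-homog -> p + q \is d.-homog.
Proof. exact: rpredD. Qed.

Lemma homogN d (p : S) : p \is d.-homog -> - p \is d.-homog.
Proof. by rewrite rpredN. Qed.

Lemma homogXn k i : ('X_i : S) ^+ k \is k.-homog.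
Proof. by have := dhomogMn k (dhomog_X C i); rewrite mul1n. Qed.

Ltac solve_homog :=
  lazymatch goal with
  | |- is_true (in_mem (GRing.add _ (GRing.opp _)) _) => simple apply homogB; solve_homog
  | |- is_true (in_mem (GRing.add _ _) _) => simple apply homogD; solve_homog
  | |- is_true (in_mem (GRing.opp _) _) => simple apply homogN; solve_homog
  | |- is_true (in_mem (GRing.mul _ _) _) =>
      simple eapply homogM; [solve_homog | solve_homog | reflexivity]
  | |- is_true (in_mem (GRing.exp _ _) _) => simple apply homogXn
  | |- is_true (in_mem (GRing.natmul _ _) _) => simple apply dhomog_nat
  | |- is_true (in_mem (mpolyX _ _) _) => simple apply dhomog_X
  end.

Lemma grad_conicsE :
  ((N^`M(o0) = y * z - 3 * x ^+ 2) * (N^`M(o1) = x * z - 3 * y ^+ 2)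
    * (N^`M(o2) = x * y))
  * (((osc_conic (1 : C))^`M(o0) = - 6 * z + 42 * x - 22 * y)
    * ((osc_conic (1 : C))^`M(o1) = - 6 * z + 42 * y - 22 * x)
    * ((osc_conic (1 : C))^`M(o2) = 2 * z - 6 * x - 6 * y))
  * (((conicA x y z)^`M(o0) = - 22 * y) * ((conicA x y z)^`M(o1) = - 22 * x)
    * ((conicA x y z)^`M(o2) = 2 * z))
  * (((conicB x y z)^`M(o0) = 42 * x) * ((conicB x y z)^`M(o1) = - 6 * z)
    * ((conicB x y z)^`M(o2) = - 6 * y))
  * (((conicC x y z)^`M(o0) = - 6 * z) * ((conicC x y z)^`M(o1) = 42 * y)
    * ((conicC x y z)^`M(o2) = - 6 * x)).
Proof.
have [g0 g1 g2] := grad_nodal C; have /= [h0 h1 h2] := grad_conic (1 : C).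
rewrite /conicA /conicB /conicC; do !split; rewrite ?(g0, g1, g2, h0, h1, h2) ?mpolyC1;
  by rewrite ?(mderiv_nat, mderiv_exp, mderiv_X, mderivM, mderivB) /=; ring.
Qed.

(** Differentiating through the three quadratic forms keeps the identities given to [ring] in
    factored shape. *)
Lemma mderiv_two_conics l : let a := conicA x y z in let b := conicB x y z in
  let c := conicC x y z in (two_conics 1 x y z)^`M(l) =
  (2 * a - b - c) * a^`M(l) + (2 * b - a - c) * b^`M(l) + (2 * c - a - b) * c^`M(l).
Proof.
rewrite /= /two_conics !expr1n !mul1r.
move: (conicA _ _ _) (conicB _ _ _) (conicC _ _ _) => a b c.
by rewrite !(mderiv_exp, mderivM, mderivB, mderivD) /=; ring.
Qed.

Lemma mderiv_three_conics l : let a := conicA x y z in let b := conicB x y z in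
  let c := conicC x y z in (three_conics x y z)^`M(l) =
  3 * (a ^+ 2 - b * c) * a^`M(l) + 3 * (b ^+ 2 - a * c) * b^`M(l)
  + 3 * (c ^+ 2 - a * b) * c^`M(l).
Proof.
rewrite /= /three_conics; move: (conicA _ _ _) (conicB _ _ _) (conicC _ _ _) => a b c.
by rewrite !(mderiv_nat, mderiv_exp, mderivM, mderivB, mderivD) /=; ring.
Qed.

Ltac solve_syz :=
  rewrite /syzygy sum_I3 !mderivM ?mderiv_two_conics ?mderiv_three_conics !grad_conicsE;
  rewrite /nodal_cubic /nodal /osc_conic /conic ?mpolyC1
    /two_conics /three_conics /conicA /conicB /conicC /vec3 /=; ring.

Ltac solve_cross :=
  rewrite /nodal_cubic /nodal /osc_conic ?mpolyC1 /conic
    /two_conics /three_conics /conicA /conicB /conicC sum_I3 /cross /vec3 /=; ring.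

Ltac solve_rel := elim/I3_ind; rewrite /vec3 /=; ring.

Lemma homog2_sym : forall i, syz2_sym C i \is 2.-homog.
Proof. rewrite /syz2_sym; elim/I3_ind; rewrite /vec3 /=; solve_homog. Qed.

Lemma homog2_anti : forall i, syz2_anti C i \is 2.-homog.
Proof. rewrite /syz2_anti; elim/I3_ind; rewrite /vec3 /=; solve_homog. Qed.

Lemma homog3_sym : forall i, syz3_sym C i \is 3.-homog.
Proof. rewrite /syz3_sym; elim/I3_ind; rewrite /vec3 /=; solve_homog. Qed.

Lemma homog3_anti : forall i, syz3_anti C i \is 3.-homog.
Proof. rewrite /syz3_anti; elim/I3_ind; rewrite /vec3 /=; solve_homog. Qed.

Lemma homog5_s : forall i, syz5_s C i \is 5.-homog.
Proof. rewrite /syz5_s; elim/I3_ind; rewrite /vec3 /=; solve_homog. Qed.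

Lemma homog5_t : forall i, syz5_t C i \is 5.-homog.
Proof. rewrite /syz5_t; elim/I3_ind; rewrite /vec3 /=; solve_homog. Qed.

Lemma homog5_p : forall i, syz5_p C i \is 5.-homog.
Proof. rewrite /syz5_p; elim/I3_ind; rewrite /vec3 /=; solve_homog. Qed.

Lemma homog5_q : forall i, syz5_q C i \is 5.-homog.
Proof. rewrite /syz5_q; elim/I3_ind; rewrite /vec3 /=; solve_homog. Qed.

Lemma homog_curve5 : curve5 C \is 5.-homog.
Proof. exact: dhomogM (nodal_homog C) (conic_homog 1). Qed.

Lemma conicABC_homog : [/\ conicA x y z \is 2.-homog, conicB x y z \is 2.-homog
  & conicC x y z \is 2.-homog].
Proof. by split; rewrite /conicA /conicB /conicC; solve_homog. Qed.

Lemma homog_curve7 : curve7 C \is 7.-homog.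
Proof.
apply: (dhomogM (nodal_homog C)); rewrite /two_conics !expr1n !mul1r.
have [] := conicABC_homog; move: (conicA _ _ _) (conicB _ _ _) (conicC _ _ _).
move=> a b c ha hb hc; have X2 (p : S) : p \is 2.-homog -> p ^+ 2 \is 4.-homog.
  by move=> hp; exact: (dhomogMn 2 hp).
have X11 (p q : S) : p \is 2.-homog -> q \is 2.-homog -> p * q \is 4.-homog.
  by move=> hp hq; exact: (dhomogM hp hq).
by rewrite !(rpredB, rpredD) // ?X2 ?X11.
Qed.

Lemma homog_curve9 : curve9 C \is 9.-homog.
Proof.
apply: (dhomogM (nodal_homog C)); rewrite /three_conics.
have [] := conicABC_homog; move: (conicA _ _ _) (conicB _ _ _) (conicC _ _ _).
move=> a b c ha hb hc; have X3 (p : S) : p \is 2.-homog -> p ^+ 3 \is 6.-homog.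
  by move=> hp; exact: (dhomogMn 3 hp).
rewrite !(rpredB, rpredD) // ?X3 //.
exact: (dhomogM (dhomogM (dhomogM (dhomog_nat C 3) ha) hb) hc).
Qed.

Lemma syzygy2_sym : syzygy (curve5 C) (syz2_sym C).
Proof. rewrite /curve5 /syz2_sym; solve_syz. Qed.

Lemma syzygy2_anti : syzygy (curve5 C) (syz2_anti C).
Proof. rewrite /curve5 /syz2_anti; solve_syz. Qed.

(** The factor 5 is the degree, contributed by Euler's formula; thus the cross product itself is 30
    times the gradient. *)
Lemma cross2 : \sum_i 'X_i * cross (syz2_sym C) (syz2_anti C) i = 5 * 30%:MP * curve5 C.
Proof. rewrite mpolyC_nat /curve5 /syz2_sym /syz2_anti; solve_cross. Qed.

Lemma syzygy3_sym : syzygy (curve7 C) (syz3_sym C).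
Proof. rewrite /curve7 /syz3_sym; solve_syz. Qed.

Lemma syzygy3_anti : syzygy (curve7 C) (syz3_anti C).
Proof. rewrite /curve7 /syz3_anti; solve_syz. Qed.

Lemma cross3 : \sum_i 'X_i * cross (syz3_sym C) (syz3_anti C) i = 7 * 182%:MP * curve7 C.
Proof. rewrite mpolyC_nat /curve7 /syz3_sym /syz3_anti; solve_cross. Qed.

Lemma syzygy5_s : syzygy (curve9 C) (syz5_s C).
Proof. rewrite /curve9 /syz5_s; solve_syz. Qed.

Lemma syzygy5_t : syzygy (curve9 C) (syz5_t C).
Proof. rewrite /curve9 /syz5_t; solve_syz. Qed.

Lemma syzygy5_p : syzygy (curve9 C) (syz5_p C).
Proof. rewrite /curve9 /syz5_p; solve_syz. Qed.

Lemma syzygy5_q : syzygy (curve9 C) (syz5_q C).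
Proof. rewrite /curve9 /syz5_q; solve_syz. Qed.

Lemma relation_spq l : x * syz5_s C l + z * syz5_p C l - 7 * y * syz5_q C l = 0.
Proof. rewrite /syz5_s /syz5_p /syz5_q; move: l; solve_rel. Qed.

Lemma relation_tpq l : y * syz5_t C l + 7 * x * syz5_p C l - z * syz5_q C l = 0.
Proof. rewrite /syz5_t /syz5_p /syz5_q; move: l; solve_rel. Qed.

Lemma cross_sp : \sum_i 'X_i * cross (syz5_s C) (syz5_p C) i = 9 * (- 91 * y ^+ 2) * curve9 C.
Proof. rewrite /curve9 /syz5_s /syz5_p; solve_cross. Qed.

Lemma cross_sq : \sum_i 'X_i * cross (syz5_s C) (syz5_q C) i = 9 * (- 13 * y * z) * curve9 C.
Proof. rewrite /curve9 /syz5_s /syz5_q; solve_cross. Qed.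

Lemma cross_tp : \sum_i 'X_i * cross (syz5_t C) (syz5_p C) i = 9 * (- 13 * x * z) * curve9 C.
Proof. rewrite /curve9 /syz5_t /syz5_p; solve_cross. Qed.

Lemma cross_tq : \sum_i 'X_i * cross (syz5_t C) (syz5_q C) i = 9 * (- 91 * x ^+ 2) * curve9 C.
Proof. rewrite /curve9 /syz5_t /syz5_q; solve_cross. Qed.

Lemma cross_pq : \sum_i 'X_i * cross (syz5_p C) (syz5_q C) i = 9 * (13 * x * y) * curve9 C.
Proof. rewrite /curve9 /syz5_p /syz5_q; solve_cross. Qed.

End ExplicitSyzygies.

Section FreeNormalForms.
Variable C : numClosedFieldType.
Local Notation S := {mpoly C[3]}.
Local Notation x := ('X_o0 : S).
Local Notation y := ('X_o1 : S).
Local Notation z := ('X_o2 : S).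

Lemma meval_neq0 (p : S) v : p.@[v] != 0 -> p != 0.
Proof. by apply: contraNneq => ->; rewrite meval0. Qed.

Ltac solve_meval :=
  rewrite ?(mevalN, mevalB, mevalD) ?mevalN !(meval_nat, meval_exp, mevalM) !mevalXU /vec3 /=;
  ring.

Lemma curve5_neq0 : curve5 C != 0.
Proof.
apply: (@meval_neq0 _ (vec3 1 0 0)); rewrite (_ : _.@[_] = - 21) ?oppr_eq0 ?pnatr_eq0 //.
by rewrite /curve5 rmorphM /= meval_nodal meval_conic /nodal /conic /vec3 /=; ring.
Qed.

Lemma curve7_neq0 : curve7 C != 0.
Proof.
apply: (@meval_neq0 _ (vec3 1 0 0)); rewrite (_ : _.@[_] = - 441) ?oppr_eq0 ?pnatr_eq0 //.
rewrite /curve7 rmorphM /= meval_nodal /nodal /two_conics /conicA /conicB /conicC expr1n !mul1r.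
rewrite !(rmorph_nat, rmorphXn, rmorphM, rmorphB, rmorphD, rmorphN) /= !mevalXU.
by rewrite /vec3 /=; ring.
Qed.

Lemma curve9_neq0 : curve9 C != 0.
Proof.
apply: (@meval_neq0 _ (vec3 1 0 0)).
rewrite (_ : _.@[_] = - (21 * 441)) ?oppr_eq0 ?mulf_neq0 ?pnatr_eq0 //.
rewrite /curve9 rmorphM /= meval_nodal /nodal /three_conics /conicA /conicB /conicC.
rewrite !(rmorph_nat, rmorphXn, rmorphM, rmorphB, rmorphD, rmorphN) /= !mevalXU.
by rewrite /vec3 /=; ring.
Qed.

Lemma syz_neq0 (rho : 'I_3 -> S) l v : (rho l).@[v] != 0 -> exists i, rho i != 0.
Proof. by move=> h; exists l; exact: meval_neq0 h. Qed.

Lemma value2_sym : (syz2_sym C o0).@[vec3 1 0 0] = 8.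
Proof. by rewrite /syz2_sym {1}/vec3 /=; solve_meval. Qed.

Lemma value2_anti : (syz2_anti C o0).@[vec3 1 0 0] = 4.
Proof. by rewrite /syz2_anti {1}/vec3 /=; solve_meval. Qed.

Lemma value3_sym : (syz3_sym C o0).@[vec3 1 0 0] = 4.
Proof. by rewrite /syz3_sym {1}/vec3 /=; solve_meval. Qed.

Lemma value3_anti : (syz3_anti C o0).@[vec3 1 0 0] = 120.
Proof. by rewrite /syz3_anti {1}/vec3 /=; solve_meval. Qed.

Lemma free_curve5 : free_curve (curve5 C) 2 2.
Proof.
apply: (free_criterion curve5_neq0 (@homog_curve5 C) (@reduced_curve5 C) _ _ _ (cross2 C)).
- split; first exact: syzygy2_sym; split; first exact: homog2_sym.
  by apply: (@syz_neq0 _ o0 (vec3 1 0 0)); rewrite value2_sym pnatr_eq0.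
- split; first exact: syzygy2_anti; split; first exact: homog2_anti.
  by apply: (@syz_neq0 _ o0 (vec3 1 0 0)); rewrite value2_anti pnatr_eq0.
by rewrite pnatr_eq0.
Qed.

Lemma free_curve7 : free_curve (curve7 C) 3 3.
Proof.
apply: (free_criterion curve7_neq0 (@homog_curve7 C) (@reduced_curve7 C) _ _ _ (cross3 C)).
- split; first exact: syzygy3_sym; split; first exact: homog3_sym.
  by apply: (@syz_neq0 _ o0 (vec3 1 0 0)); rewrite value3_sym pnatr_eq0.
- split; first exact: syzygy3_anti; split; first exact: homog3_anti.
  by apply: (@syz_neq0 _ o0 (vec3 1 0 0)); rewrite value3_anti pnatr_eq0.
by rewrite pnatr_eq0.
Qed.

Definition gens9 : 'I_4 -> 'I_3 -> S :=
  vec4 (syz5_s C) (syz5_t C) (syz5_p C) (syz5_q C).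

Lemma msyzygy_curve9 : msyzygy_curve (curve9 C) (fun _ : 'I_4 => 5%N).
Proof.
have nf := curve9_neq0; have hf := @homog_curve9 C; have rf := @reduced_curve9 C.
have ss := @syzygy5_s C; have st := @syzygy5_t C.
have sp := @syzygy5_p C; have sq := @syzygy5_q C.
have cr u v m su sv E l := @cross_eq C (curve9 C) m 8 u v l nf hf su sv E.
have msp := cr _ _ _ ss sp (cross_sp C); have msq := cr _ _ _ ss sq (cross_sq C).
have mtp := cr _ _ _ st sp (cross_tp C); have mtq := cr _ _ _ st sq (cross_tq C).
have mpq := cr _ _ _ sp sq (cross_pq C).
have [k nk] := grad_neq0 nf hf.
have minimal := four_generators_minimal nk msp msq mtp mtq mpq.
exists gens9; split; last first.
  split; last exact: minimal.
  exact: (four_generators nf hf rf ss st sp sq (@relation_spq C) (@relation_tpq C)).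
move=> j; split.
  by rewrite /gens9; elim/I4_ind: j; rewrite /vec4 /=.
split=> [i|].
  by rewrite /gens9; elim/I4_ind: j; rewrite /vec4 /=;
    [exact: homog5_s | exact: homog5_t | exact: homog5_p | exact: homog5_q].
(* A zero generator would be the combination of the others with all coefficients zero, against
   minimality. *)
have [//|h] := pselect (exists i, gens9 j i != 0).
case: (minimal j); exists (fun=> 0) => i; rewrite big1 => [|l _]; last by rewrite mul0r.
by apply/eqP/negPn/negP => nz; apply: h; exists i.
Qed.

End FreeNormalForms.

(** * Normal form of a nodal cubic *)

Section NormalForm.
Variable C : numClosedFieldType.
Local Notation S := {mpoly C[3]}.
Local Notation N := (nodal_cubic C).
Local Notation x := ('X_o0 : S).
Local Notation y := ('X_o1 : S).
Local Notation z := ('X_o2 : S).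
Local Notation actp := (actm (@idfun C)).

Definition mat3 (u v w : 'I_3 -> C) : 'M[C]_3 := \matrix_(i, j) vec3 u v w i j.

Lemma lsub_mat3 u v w : let A := mat3 u v w in
  [/\ lsub A x = (u o0)%:MP * x + (u o1)%:MP * y + (u o2)%:MP * z,
      lsub A y = (v o0)%:MP * x + (v o1)%:MP * y + (v o2)%:MP * z
    & lsub A z = (w o0)%:MP * x + (w o1)%:MP * y + (w o2)%:MP * z].
Proof. by split; rewrite lsubX /actm sum_I3 !mxE. Qed.

Lemma mat3_inv u v w u' v' w' :
  (forall j, vec3 (vec3 1 0 0) (vec3 0 1 0) (vec3 0 0 1) o0 j =
     u o0 * u' j + u o1 * v' j + u o2 * w' j) ->
  (forall j, vec3 (vec3 1 0 0) (vec3 0 1 0) (vec3 0 0 1) o1 j =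
     v o0 * u' j + v o1 * v' j + v o2 * w' j) ->
  (forall j, vec3 (vec3 1 0 0) (vec3 0 1 0) (vec3 0 0 1) o2 j =
     w o0 * u' j + w o1 * v' j + w o2 * w' j) ->
  mat3 u v w \in unitmx.
Proof.
move=> h0 h1 h2; apply: (proj1 (mulmx1_unit (_ : _ *m mat3 u' v' w' = 1%:M))).
apply/matrixP; elim/I3_ind => j; rewrite !mxE sum_I3 !mxE /=.
- by rewrite {1 3 5}/vec3 /= -h0; elim/I3_ind: j.
- by rewrite {1 3 5}/vec3 /= -h1; elim/I3_ind: j.
by rewrite {1 3 5}/vec3 /= -h2; elim/I3_ind: j.
Qed.

(** The determinant of the two linear factors is a square root of the discriminant, so distinct
    roots give independent factors. The case [a = 0] is separate because the factors are found by
    dividing by [a]. *)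
Lemma quadratic_split (a b c : C) : b ^+ 2 - 4 * a * c != 0 ->
  exists al be ga de, [/\ al * de - be * ga != 0, a = al * ga,
    b = al * de + be * ga & c = be * de].
Proof.
move=> disc; have [a0|na] := eqVneq a 0.
  exists 0, 1, b, c; split; rewrite ?a0; try ring.
  move: disc; rewrite a0 mulr0 mul0r subr0 expf_eq0 /= => nb.
  by rewrite (_ : _ - _ = - b) ?oppr_eq0 //; ring.
set s := sqrtC (b ^+ 2 - 4 * a * c).
have s2 : s ^+ 2 = b ^+ 2 - 4 * a * c by rewrite sqrtCK.
have ns : s != 0 by apply: contraNneq disc => s0; rewrite -s2 s0 expr0n.
exists a, ((b - s) / 2), 1, ((b + s) / (2 * a)).
have n2 : 2 != 0 :> C by rewrite pnatr_eq0.
split.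
- by rewrite (_ : _ - _ = s) //; field; rewrite na.
- by rewrite mulr1.
- by field; rewrite na.
transitivity ((b ^+ 2 - s ^+ 2) / (4 * a)); last by field; rewrite na.
by rewrite s2; field; rewrite na.
Qed.

Lemma unitmx_to_pt (p : 'I_3 -> C) : nonzero_pt p ->
  exists2 B : 'M[C]_3, B \in unitmx & actp B (vec3 0 0 1) = p.
Proof.
move=> [i pi]; pose u : 'rV[C]_3 := \row_j p j.
have nu : u != 0.
  by apply: contraNneq pi => /rowP /(_ i); rewrite !mxE => ->.
(* A nonzero row is a scalar times the first row of the invertible matrix [row_ebase u]; the
   permutation then moves that row to the last place, for the node is wanted at (0 : 0 : 1). *)
have := mulmx_ebase u; rewrite rank_rV nu /= (mx11_scalar (col_ebase u)).
set c := col_ebase u 0 0; rewrite mul_scalar_mx -scalemxAl => E.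
have pE j : p j = c * row_ebase u o0 j.
  have := congr1 (fun v : 'rV_3 => v 0 j) E; rewrite !mxE => <-.
  congr (_ * _); rewrite (bigD1 o0) //= big1 ?addr0 => [|k k0].
    by rewrite mxE /= mul1r.
  by rewrite mxE /= (_ : (0%N == k) = false) ?mul0r //; apply: contraNF k0 => /eqP k0;
    apply/eqP/val_inj.
have nc : c != 0 by apply: contraNneq pi => c0; rewrite pE c0 mul0r.
exists (tperm_mx o0 o2 *m (c *: row_ebase u))^T.
  rewrite unitmx_tr unitmx_mul unitmx_perm /= unitmxZ ?unitfE //.
  exact: row_ebase_unit.
apply: funext => k; rewrite /actm sum_I3 /vec3 /= !mulr0 !add0r mulr1 mxE.
by rewrite -xrowE !mxE tpermR pE.
Qed.

Lemma hessian_lsub A (F : S) v :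
  hessian_at (lsub A F) v = A^T *m hessian_at F (actp A v) *m A.
Proof.
apply/matrixP => i j.
transitivity (\sum_k \sum_l A k i * A l j * (F^`M(k)^`M(l)).@[actp A v]).
  rewrite mxE mderiv_lsub /actm (raddf_sum (mderiv j)) (raddf_sum (meval v)).
  apply: eq_bigr => k _; rewrite /= mderiv_mulC rmorphM /= mevalC mxE.
  rewrite mderiv_lsub /actm (raddf_sum (meval v)) mulr_sumr; apply: eq_bigr => l _.
  by rewrite /= rmorphM /= mevalC mxE meval_lsub mulrA.
rewrite exchange_big !mxE; apply: eq_bigr => l _; rewrite !mxE mulr_suml.
by apply: eq_bigr => k _; rewrite !mxE mulrAC.
Qed.

(** The Hessian changes by congruence, so the rank condition defining a node does not depend on
    coordinates. *)
Lemma rank_hessian_lsub A (F : S) v : A \in unitmx ->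
  \rank (hessian_at (lsub A F) v) = \rank (hessian_at F (actp A v)).
Proof.
move=> uA; rewrite hessian_lsub mxrankMfree ?row_free_unit //.
by rewrite -mxrank_tr trmx_mul trmxK mxrankMfree ?row_free_unit // mxrank_tr.
Qed.

End NormalForm.

(** * Coordinates adapted to the node and its two branches *)

Section NodeCoordinates.
Variable C : numClosedFieldType.
Local Notation S := {mpoly C[3]}.
Local Notation N := (nodal_cubic C).
Local Notation x := ('X_o0 : S).
Local Notation y := ('X_o1 : S).
Local Notation z := ('X_o2 : S).
Local Notation actp := (actm (@idfun C)).

Lemma rank_rank1 m n (u : 'cV[C]_m) (v : 'rV[C]_n) : (\rank (u *m v) <= 1)%N.
Proof. exact: leq_trans (mxrankM_maxl u v) (rank_leq_col u). Qed.

(* The quadratic factor is the tangent cone at the node. *)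
Lemma node_form (G : S) : G \is 3.-homog -> node_pt G (vec3 0 0 1) ->
  exists a b c d e f g : C, b ^+ 2 - 4 * a * c != 0 /\
  G = z * (a%:MP * x ^+ 2 + b%:MP * (x * y) + c%:MP * y ^+ 2)
    + (d%:MP * x ^+ 3 + e%:MP * (x ^+ 2 * y) + f%:MP * (x * y ^+ 2) + g%:MP * y ^+ 3).
Proof.
move=> /homog3E [c0 [c1 [c2 [c3 [c4 [c5 [c6 [c7 [c8 [c9 GE]]]]]]]]]].
case=> -[_ [on sing]] rk; exists c4, c5, c6, c0, c1, c2, c3.
have dG : [/\ G^`M(o0) = 3%:MP * c0%:MP * x ^+ 2 + 2%:MP * c1%:MP * (x * y) + c2%:MP * y ^+ 2
     + 2%:MP * c4%:MP * (x * z) + c5%:MP * (y * z) + c7%:MP * z ^+ 2,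
   G^`M(o1) = c1%:MP * x ^+ 2 + 2%:MP * c2%:MP * (x * y) + 3%:MP * c3%:MP * y ^+ 2
     + c5%:MP * (x * z) + 2%:MP * c6%:MP * (y * z) + c8%:MP * z ^+ 2
 & G^`M(o2) = c4%:MP * x ^+ 2 + c5%:MP * (x * y) + c6%:MP * y ^+ 2
     + 2%:MP * c7%:MP * (x * z) + 2%:MP * c8%:MP * (y * z) + 3%:MP * c9%:MP * z ^+ 2].
  by rewrite GE; split; rewrite !(mderiv_exp, mderivC, mderiv_X, mderivM, mderivD) /=
    !mpolyC_nat; ring.
have [d0 d1 d2] := dG.
have c9E : c9 = 0.
  move: on; rewrite /on_curve GE !mevalD !(meval_exp, mevalM, mevalXU, mevalC).
  by rewrite /vec3 /= => <-; ring.
have c7E : c7 = 0.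
  move: (sing o0); rewrite d0 !mevalD !(meval_exp, mevalM, mevalXU, mevalC).
  by rewrite /vec3 /= => <-; ring.
have c8E : c8 = 0.
  move: (sing o1); rewrite d1 !mevalD !(meval_exp, mevalM, mevalXU, mevalC).
  by rewrite /vec3 /= => <-; ring.
have at_node (a b c : C) : (a%:MP * x + b%:MP * y + c%:MP * z).@[vec3 0 0 1] = c.
  by rewrite !mevalD !mevalM !mevalC !mevalXU /vec3 /=; ring.
have [e00 e01 e02] : [/\
    G^`M(o0)^`M(o0) = (6 * c0)%:MP * x + (2 * c1)%:MP * y + (2 * c4)%:MP * z,
    G^`M(o0)^`M(o1) = (2 * c1)%:MP * x + (2 * c2)%:MP * y + c5%:MP * z
  & G^`M(o0)^`M(o2) = (2 * c4)%:MP * x + c5%:MP * y + (2 * c7)%:MP * z].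
  split; rewrite d0 !(mderivC, mderiv_exp, mderiv_X, mderivM, mderivD) /=;
    by rewrite !mpolyCM !mpolyC_nat; ring.
have [e11 e12 e22] : [/\
    G^`M(o1)^`M(o1) = (2 * c2)%:MP * x + (6 * c3)%:MP * y + (2 * c6)%:MP * z,
    G^`M(o1)^`M(o2) = c5%:MP * x + (2 * c6)%:MP * y + (2 * c8)%:MP * z
  & G^`M(o2)^`M(o2) = (2 * c7)%:MP * x + (2 * c8)%:MP * y + (6 * c9)%:MP * z].
  split; rewrite ?d1 ?d2 !(mderivC, mderiv_exp, mderiv_X, mderivM, mderivD) /=;
    by rewrite !mpolyCM !mpolyC_nat; ring.
have H : hessian_at G (vec3 0 0 1) =
    mat3 (vec3 (2 * c4) c5 0) (vec3 c5 (2 * c6) 0) (vec3 0 0 0).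
  apply/matrixP; elim/I3_ind; elim/I3_ind; rewrite !mxE /vec3 /= -/(vec3 _ _ _);
    rewrite ?[_^`M(o1)^`M(o0)]mderiv_comm ?[_^`M(o2)^`M(_)]mderiv_comm;
    rewrite ?(e00, e01, e02, e11, e12, e22) at_node ?c7E ?c8E ?c9E ?mulr0 //.
split; last by rewrite GE c7E c8E c9E mpolyC0; ring.
(* If the discriminant vanishes, the tangent cone is a constant times a square, and the Hessian is a
   column times a row, of rank at most 1. *)
apply/eqP => disc; move: rk; rewrite H; have [c40|n4] := eqVneq c4 0.
  have c50 : c5 = 0.
    by move/eqP: disc; rewrite c40 mulr0 mul0r subr0 expf_eq0 => /eqP.
  move=> rk; have := rank_rank1 (\col_i vec3 0 1 0 i) (\row_j vec3 0 (2 * c6) 0 j : 'rV[C]_3).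
  have -> : (\col_i vec3 0 1 0 i) *m (\row_j vec3 0 (2 * c6) 0 j) =
      mat3 (vec3 (2 * c4) c5 0) (vec3 c5 (2 * c6) 0) (vec3 0 0 0) :> 'M[C]_3.
    apply/matrixP; elim/I3_ind; elim/I3_ind; rewrite !mxE big_ord1 !mxE /vec3 /=;
      rewrite ?c40 ?c50; ring.
  by rewrite rk.
move=> rk; have := rank_rank1 (\col_i vec3 (2 * c4) c5 0 i)
  (\row_j vec3 1 (c5 / (2 * c4)) 0 j : 'rV[C]_3).
have n2 : 2 != 0 :> C by rewrite pnatr_eq0.
have -> : (\col_i vec3 (2 * c4) c5 0 i) *m (\row_j vec3 1 (c5 / (2 * c4)) 0 j) =
    mat3 (vec3 (2 * c4) c5 0) (vec3 c5 (2 * c6) 0) (vec3 0 0 0) :> 'M[C]_3.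
  have c5E : c5 ^+ 2 = 4 * c4 * c6 by apply/eqP; rewrite -subr_eq0 disc.
  have e : c5 * (c5 / (2 * c4)) = 2 * c6.
    by transitivity (c5 ^+ 2 / (2 * c4)); [ring | rewrite c5E; field; rewrite n4].
  apply/matrixP; elim/I3_ind; elim/I3_ind; rewrite !mxE big_ord1 !mxE /vec3 /= ?e;
    by [ring | field; rewrite n4].
by rewrite rk.
Qed.

Definition axial_cubic (a b : C) : S := x * y * z + a%:MP * x ^+ 3 + b%:MP * y ^+ 3.

Lemma lsub_axial A a b : lsub A (axial_cubic a b) =
  lsub A x * lsub A y * lsub A z + a%:MP * lsub A x ^+ 3 + b%:MP * lsub A y ^+ 3.
Proof. by rewrite /axial_cubic !(rmorphXn, rmorphM, rmorphD) /= !lsubC. Qed.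

(** The two branch tangents become the axes x = 0 and y = 0. The mixed terms x^2 y and x y^2 are
    then xy times a linear form, which is absorbed into z. *)
Lemma node_form_axial (G : S) : G \is 3.-homog -> node_pt G (vec3 0 0 1) ->
  exists A a b, A \in unitmx /\ G = lsub A (axial_cubic a b).
Proof.
move=> hG /(node_form hG) [a [b [c [d [e [f [g [disc GE]]]]]]]].
have [al [be [ga [de [D aE bE cE]]]]] := quadratic_split disc.
set D' := al * de - be * ga in D.
(* These are the entries of the inverse of the matrix of the two tangent forms; [u], [m1], [m2], [v]
   are the coefficients of the cubic part in the new coordinates. *)
pose p := de / D'; pose q := - be / D'; pose r := - ga / D'; pose s := al / D'.
pose u := d * p ^+ 3 + e * p ^+ 2 * r + f * p * r ^+ 2 + g * r ^+ 3.
pose v := d * q ^+ 3 + e * q ^+ 2 * s + f * q * s ^+ 2 + g * s ^+ 3.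
pose m1 := 3 * d * p ^+ 2 * q + e * (p ^+ 2 * s + 2 * p * q * r)
   + f * (2 * p * r * s + q * r ^+ 2) + 3 * g * r ^+ 2 * s.
pose m2 := 3 * d * p * q ^+ 2 + e * (q ^+ 2 * r + 2 * p * q * s)
   + f * (2 * q * r * s + p * s ^+ 2) + 3 * g * r * s ^+ 2.
pose k0 := m1 * al + m2 * ga; pose k1 := m1 * be + m2 * de.
exists (mat3 (vec3 al be 0) (vec3 ga de 0) (vec3 k0 k1 1)), u, v.
split.
  apply: (@mat3_inv _ _ _ _ (vec3 p q 0) (vec3 r s 0)
    (vec3 (- (k0 * p + k1 * r)) (- (k0 * q + k1 * s)) 1)); elim/I3_ind;
    rewrite /vec3 /= /p /q /r /s /D'; by [ring | field].
have [lx ly lz] := lsub_mat3 (vec3 al be 0) (vec3 ga de 0) (vec3 k0 k1 1).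
rewrite lsub_axial lx ly lz /vec3 /= mpolyC0 mpolyC1.
pose X1 := al%:MP * x + be%:MP * y; pose Y1 := ga%:MP * x + de%:MP * y.
have xE : x = p%:MP * X1 + q%:MP * Y1.
  rewrite /X1 /Y1; transitivity ((p * al + q * ga)%:MP * x + (p * be + q * de)%:MP * y).
    rewrite (_ : p * al + q * ga = 1); last by rewrite /p /q /D'; field.
    rewrite (_ : p * be + q * de = 0); last by rewrite /p /q /D'; field.
    by rewrite mpolyC1 mpolyC0; ring.
  by rewrite !(mpolyCM, mpolyCD); ring.
have yE : y = r%:MP * X1 + s%:MP * Y1.
  rewrite /X1 /Y1; transitivity ((r * al + s * ga)%:MP * x + (r * be + s * de)%:MP * y).
    rewrite (_ : r * al + s * ga = 0); last by rewrite /r /s /D'; field.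
    rewrite (_ : r * be + s * de = 1); last by rewrite /r /s /D'; field.
    by rewrite mpolyC1 mpolyC0; ring.
  by rewrite !(mpolyCM, mpolyCD); ring.
have qE : a%:MP * x ^+ 2 + b%:MP * (x * y) + c%:MP * y ^+ 2 = X1 * Y1.
  by rewrite /X1 /Y1 aE bE cE !(mpolyCM, mpolyCD); ring.
have kE : k0%:MP * x + k1%:MP * y = m1%:MP * X1 + m2%:MP * Y1.
  rewrite /k0 /k1 /X1 /Y1; move: (m1) (m2) => n1 n2.
  by rewrite !(mpolyCM, mpolyCD); ring.
have cE' : d%:MP * x ^+ 3 + e%:MP * (x ^+ 2 * y) + f%:MP * (x * y ^+ 2) + g%:MP * y ^+ 3
    = u%:MP * X1 ^+ 3 + v%:MP * Y1 ^+ 3 + X1 * Y1 * (m1%:MP * X1 + m2%:MP * Y1).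
  rewrite {}xE {}yE; move: X1 Y1 {qE kE lx ly lz} => X1 Y1; rewrite /u /v /m1 /m2.
  move: p q r s @u @v @m1 @m2 @k0 @k1 => p q r s _ _ _ _ _ _.
  by rewrite !(mpolyC_nat, rmorphXn, mpolyCM, mpolyCD) /=; ring.
rewrite !mul0r !addr0 mul1r GE qE cE' -/X1 -/Y1 kE; ring.
Qed.

Lemma lsub_const A (P : S) c : A \in unitmx -> lsub A P = c%:MP -> P = c%:MP.
Proof. by move=> uA h; rewrite -[P](lsubK uA) h lsubC. Qed.

(** If [a = 0] the cubic is divisible by y, and if [b = 0] by x. Neither factor is constant, since
    each has a nonzero derivative. *)
Lemma irreducible_axial (F : S) A a b : A \in unitmx -> irreducible_mpoly F ->
  F = lsub A (axial_cubic a b) -> a != 0 /\ b != 0.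
Proof.
move=> uA [_ irr] FE.
have nvar i c : 'X_i <> c%:MP :> S.
  move=> /(congr1 (mderiv i)); rewrite mderiv_X mderivC eqxx => /eqP.
  by rewrite oner_eq0.
have nquad i j k c d : i != j -> i != k -> j != k ->
    'X_i * 'X_j + d%:MP * 'X_k ^+ 2 <> c%:MP :> S.
  move=> ij ik jk /(congr1 (mderiv i)).
  rewrite mderivC !(mderiv_exp, mderivC, mderiv_X, mderivM, mderivD) eqxx.
  rewrite (eq_sym j) (eq_sym k) (negbTE ij) (negbTE ik) mul1r !mulr0 mul0r !addr0 => /eqP.
  by rewrite (negbTE (X_neq0 _ _)).
have split_axial (P Q : S) : axial_cubic a b = P * Q ->
    (exists c, P = c%:MP) \/ (exists c, Q = c%:MP).
  move=> E; have := irr (lsub A P) (lsub A Q); rewrite FE E rmorphM => /(_ erefl).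
  by case=> [[c /(lsub_const uA)]|[c /(lsub_const uA)]]; [left | right]; exists c.
split; apply/eqP => e0.
  have E : axial_cubic a b = y * (x * z + b%:MP * y ^+ 2).
    by rewrite /axial_cubic e0 mpolyC0; ring.
  by have [[c /nvar]|[c /nquad]] := split_axial _ _ E; [|exact].
have E : axial_cubic a b = x * (y * z + a%:MP * x ^+ 2).
  by rewrite /axial_cubic e0 mpolyC0; ring.
by have [[c /nvar]|[c /nquad]] := split_axial _ _ E; [|exact].
Qed.

Lemma axial_rescale a b : a != 0 -> b != 0 ->
  exists2 A, A \in unitmx & axial_cubic a b = lsub A N.
Proof.
move=> na nb; pose r := 3.-root (- a); pose s := 3.-root (- b).
have r3 : r ^+ 3 = - a by rewrite rootCK.
have s3 : s ^+ 3 = - b by rewrite rootCK.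
have nr : r != 0.
  by apply: contraNneq na => r0; rewrite -oppr_eq0 -r3 r0 expr0n.
have ns : s != 0.
  by apply: contraNneq nb => s0; rewrite -oppr_eq0 -s3 s0 expr0n.
exists (mat3 (vec3 r 0 0) (vec3 0 s 0) (vec3 0 0 (r * s)^-1)).
  apply: (@mat3_inv _ _ _ _ (vec3 r^-1 0 0) (vec3 0 s^-1 0) (vec3 0 0 (r * s)));
    elim/I3_ind; rewrite /vec3 /=; by [ring | field; rewrite ?nr ?ns].
have [lx ly lz] := lsub_mat3 (vec3 r 0 0) (vec3 0 s 0) (vec3 0 0 (r * s)^-1).
rewrite (rmorph_nodal (lsub _)) /= lx ly lz /vec3 /= !mpolyC0 !mul0r !addr0 !add0r /nodal.
have aE : a = - r ^+ 3 by rewrite r3 opprK.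
have bE : b = - s ^+ 3 by rewrite s3 opprK.
rewrite /axial_cubic aE bE !mpolyCN !rmorphXn /=.
have k : r%:MP * s%:MP * ((r * s)^-1)%:MP = 1 :> S.
  by rewrite -!mpolyCM mulfV ?mpolyC1 // mulf_neq0.
transitivity (r%:MP * s%:MP * ((r * s)^-1)%:MP * (x * y * z)
  - r%:MP ^+ 3 * x ^+ 3 - s%:MP ^+ 3 * y ^+ 3); first by rewrite k; ring.
ring.
Qed.

Lemma nodal_normal_form (F : S) : irreducible_nodal_cubic F ->
  exists2 A, A \in unitmx & F = lsub A N.
Proof.
move=> [hF [irr [p [[[np [on sing]] rk] _]]]].
have [B uB Bp] := unitmx_to_pt np.
have nG : node_pt (lsub B F) (vec3 0 0 1).
  split; last by rewrite rank_hessian_lsub // Bp.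
  split; first by exists o2; rewrite oner_neq0.
  split; first by rewrite /on_curve meval_lsub Bp.
  move=> i; rewrite grad_lsub Bp (_ : (fun k => _) = fun=> 0) ?actm0 //.
  by apply: funext => k.
have [A [a [b [uA GE]]]] := node_form_axial (dhomog_lsub B hF) nG.
have FE : F = lsub (A *m invmx B) (axial_cubic a b).
  by rewrite -lsub_mul -GE lsubK.
have uAB : A *m invmx B \in unitmx by rewrite unitmx_mul uA unitmx_inv.
have [na nb] := irreducible_axial uAB irr FE.
have [D uD DE] := axial_rescale na nb.
exists (D *m (A *m invmx B)); first by rewrite unitmx_mul uD.
by rewrite -lsub_mul -DE.
Qed.

End NodeCoordinates.

(** * The theorem *)

Section Assembly.
Variable C : numClosedFieldType.
Local Notation S := {mpoly C[3]}.
Local Notation N := (nodal_cubic C).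
Local Notation x := ('X_o0 : S).
Local Notation y := ('X_o1 : S).
Local Notation z := ('X_o2 : S).
Local Notation actp := (actm (@idfun C)).

Lemma same_pt_sym (p q : 'I_3 -> C) : same_pt p q -> same_pt q p.
Proof.
move=> [c [nc h]]; exists c^-1; rewrite invr_eq0; split=> // i.
by rewrite h mulrA mulVf // mul1r.
Qed.

Lemma same_pt_trans (p q r : 'I_3 -> C) : same_pt p q -> same_pt q r -> same_pt p r.
Proof.
move=> [c [nc h]] [d [nd k]]; exists (d * c); split=> [|i]; first by rewrite mulf_neq0.
by rewrite k h mulrA.
Qed.

Definition root_scale (w : C) : 'M[C]_3 :=
  mat3 (vec3 (w ^+ 2) 0 0) (vec3 0 w 0) (vec3 0 0 1).

Lemma root_scale_unit w : w != 0 -> root_scale w \in unitmx.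
Proof.
move=> nw; apply: (@mat3_inv _ _ _ _ (vec3 (w ^+ 2)^-1 0 0) (vec3 0 w^-1 0) (vec3 0 0 1));
  elim/I3_ind; rewrite /vec3 /=; by [ring | field].
Qed.

Lemma lsub_root_scale w : [/\ lsub (root_scale w) x = w%:MP ^+ 2 * x,
  lsub (root_scale w) y = w%:MP * y & lsub (root_scale w) z = z].
Proof.
have [-> -> ->] := lsub_mat3 (vec3 (w ^+ 2) 0 0) (vec3 0 w 0) (vec3 0 0 1).
by rewrite /vec3 /= !mpolyC0 mpolyC1 rmorphXn /= !(mul0r, addr0, add0r, mul1r).
Qed.

Lemma lsub_scale_nodal w : w ^+ 3 = 1 -> lsub (root_scale w) N = N.
Proof.
move=> w3; have [lx ly lz] := lsub_root_scale w.
by rewrite (rmorph_nodal (lsub _)) /= lx ly lz nodal_rescale // cubeC.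
Qed.

Lemma lsub_scale_curve5 w : w ^+ 3 = 1 ->
  lsub (root_scale w) (curve5 C) = N * osc_conic w.
Proof.
move=> w3; have [lx ly lz] := lsub_root_scale w.
rewrite rmorphM /= lsub_scale_nodal //; congr (_ * _).
rewrite (rmorph_conic (lsub _)) /= lx ly lz lsubC mpolyC1.
exact: conic_rescale (cubeC w3).
Qed.

Lemma rmorph_two_conics (T T' : comNzRingType) (g : {rmorphism T -> T'}) u a b c :
  g (two_conics u a b c) = two_conics (g u) (g a) (g b) (g c).
Proof.
rewrite /two_conics /conicA /conicB /conicC.
by rewrite !(rmorph_nat, rmorphXn, rmorphM, rmorphB, rmorphD).
Qed.

(** Scaling by a root multiplies the parameters of all conics by it. [curve7] misses the parameter
    1, so the scale must be the root missing from the given pair, which is -(v + w). *)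
Lemma lsub_scale_curve7 v w : v ^+ 3 = 1 -> w ^+ 3 = 1 -> v != w ->
  lsub (root_scale (- (v + w))) (curve7 C) = N * (osc_conic v * osc_conic w).
Proof.
move=> v3 w3 vw; have u3 := third_root v3 w3 vw.
have [lx ly lz] := lsub_root_scale (- (v + w)).
rewrite rmorphM /= lsub_scale_nodal //; congr (_ * _).
rewrite (rmorph_two_conics (lsub _)) /= lx ly lz rmorph1.
rewrite (two_conics_rescale _ _ _ (cubeC u3)) mpolyCN mpolyCD; apply/esym.
apply: (two_conicsE x y z (cubeC v3) (cubeC w3)).
rewrite -!rmorphXn -rmorphM -!rmorphD /= -[RHS]mpolyC0; congr (_%:MP).
exact: cube_roots_sum.
Qed.

Lemma curve9E u v w : u ^+ 3 = 1 -> v ^+ 3 = 1 -> w ^+ 3 = 1 ->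
  u != v -> u != w -> v != w ->
  curve9 C = N * (osc_conic u * (osc_conic v * osc_conic w)).
Proof.
move=> u3 v3 w3 uv uw vw.
have uE : u = - (v + w).
  (* The quadratic relations of the pairs (u, v) and (u, w) differ by this product. *)
  have : (v - w) * (u + v + w) = 0.
    transitivity ((u ^+ 2 + u * v + v ^+ 2) - (u ^+ 2 + u * w + w ^+ 2)); first ring.
    by rewrite !cube_roots_sum // subr0.
  by move/eqP; rewrite mulf_eq0 subr_eq0 (negbTE vw) -addrA addr_eq0 => /eqP.
have h : v%:MP ^+ 2 + v%:MP * w%:MP + w%:MP ^+ 2 = 0 :> S.
  rewrite -!rmorphXn -rmorphM -!rmorphD /= -[RHS]mpolyC0; congr (_%:MP).
  exact: cube_roots_sum.
rewrite /curve9 -(three_conicsE x y z (cubeC u3)); congr (_ * (_ * _)).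
rewrite (_ : u%:MP = - (v%:MP + w%:MP)); last by rewrite -mpolyCD -mpolyCN uE.
by rewrite -(two_conicsE x y z (cubeC v3) (cubeC w3) h).
Qed.

Section Fixed.
Variables (A : 'M[C]_3) (uA : A \in unitmx).
Local Notation F := (lsub A N).

Lemma sextactic_root p : sextactic_pt F p ->
  exists w, w ^+ 3 = 1 /\ same_pt (sext_pt w) (actp A p).
Proof. by move/(sextactic_lsub uA)/sextactic_nodal. Qed.

Lemma hyperosc_conicE p Q w : w ^+ 3 = 1 -> same_pt (sext_pt w) (actp A p) ->
  hyperosculating_conic F Q p -> exists c, c != 0 /\ Q = c *: lsub A (osc_conic w).
Proof.
move=> w3 sp /(hyperosc_lsub uA) /(hyperosc_nodal w3 sp) [c [nc E]].
by exists c; split=> //; rewrite -lsubZ -E lsubVK.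
Qed.

Lemma root_neq p q v w : same_pt (sext_pt v) (actp A p) ->
  same_pt (sext_pt w) (actp A q) -> ~ same_pt p q -> v != w.
Proof.
move=> sp sq npq; apply/eqP => vw; apply: npq; apply/(same_pt_actE p q uA).
by apply: same_pt_trans (same_pt_sym sp) _; rewrite vw.
Qed.

Lemma three_sextactic : exists p : 'I_3 -> 'I_3 -> C,
  (forall k, sextactic_pt F (p k)) /\
  (forall k l, k != l -> ~ same_pt (p k) (p l)) /\
  (forall q, sextactic_pt F q -> exists k, same_pt (p k) q).
Proof.
have [w [w3 E]] := exists_omega C.
pose r : 'I_3 -> C := vec3 1 w (w ^+ 2).
have r3 : forall k, r k ^+ 3 = 1.
  by elim/I3_ind; rewrite /r /vec3 /= ?expr1n // -exprM mulnC exprM w3 expr1n.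
have uV : invmx A \in unitmx by rewrite unitmx_inv.
have n1 : w != 1.
  apply/eqP => w1; move: E; rewrite w1 expr1n => /eqP.
  by rewrite (_ : 1 + 1 + 1 = 3) ?pnatr_eq0 //; ring.
have n2 : w ^+ 2 != w.
  by rewrite expr2 -[X in _ != X]mulr1 (inj_eq (mulfI (cube_neq0 w3))).
have n3 : w ^+ 2 != 1.
  by apply: contraNneq n1 => h; rewrite -w3 exprSr h mul1r.
have r_inj k l : r k = r l -> k = l.
  elim/I3_ind: k; elim/I3_ind: l; rewrite /r /vec3 //= => /eqP;
    by rewrite 1?eq_sym ?(negbTE n1) ?(negbTE n2) ?(negbTE n3) // 1?eq_sym
      ?(negbTE n1) ?(negbTE n2) ?(negbTE n3).
exists (fun k => actp (invmx A) (sext_pt (r k))); split=> [k|].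
  by apply: sextactic_lsubV => //; exact: sext_pt_sextactic.
split=> [k l kl /(same_pt_actE _ _ uV) /same_sext_pt /r_inj h|q].
  by rewrite h eqxx in kl.
move=> /sextactic_root [v [v3 sv]].
have [k rk] : exists k, r k = v.
  have : (v - 1) * ((v - w) * (v - w ^+ 2)) = 0.
    transitivity ((v ^+ 3 - 1) + (v - v ^+ 2) * (w ^+ 2 + w + 1) + (v - 1) * (w ^+ 3 - 1)).
      ring.
    by rewrite v3 w3 E !subrr !mulr0 !addr0.
  move/eqP; rewrite !mulf_eq0 !subr_eq0 => /orP[|/orP[]] /eqP ->;
    by [exists o0 | exists o1 | exists o2].
exists k; rewrite rk -[q](actpK uA); exact: same_pt_act.
Qed.

End Fixed.

(** Characteristic 0 and the existence of roots are what the argument uses of the complex numbers,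
    so any [numClosedFieldType] is allowed here. *)
Lemma nodal_cubic_theorem (F : S) : irreducible_nodal_cubic F ->
  (exists p : 'I_3 -> 'I_3 -> C,
      (forall k, sextactic_pt F (p k)) /\
      (forall k l, k != l -> ~ same_pt (p k) (p l)) /\
      (forall q, sextactic_pt F q -> exists k, same_pt (p k) q)) /\
  (forall p Q Q', sextactic_pt F p -> hyperosculating_conic F Q p ->
      hyperosculating_conic F Q' p -> exists c : C, c != 0 /\ Q' = c *: Q) /\
  (forall p Q, sextactic_pt F p -> hyperosculating_conic F Q p ->
      free_curve (F * Q) 2 2) /\
  (forall p1 p2 Q1 Q2,
      sextactic_pt F p1 -> sextactic_pt F p2 -> ~ same_pt p1 p2 ->
      hyperosculating_conic F Q1 p1 -> hyperosculating_conic F Q2 p2 ->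
      free_curve (F * Q1 * Q2) 3 3) /\
  (forall p1 p2 p3 Q1 Q2 Q3,
      sextactic_pt F p1 -> sextactic_pt F p2 -> sextactic_pt F p3 ->
      ~ same_pt p1 p2 -> ~ same_pt p1 p3 -> ~ same_pt p2 p3 ->
      hyperosculating_conic F Q1 p1 -> hyperosculating_conic F Q2 p2 ->
      hyperosculating_conic F Q3 p3 ->
      msyzygy_curve (F * Q1 * Q2 * Q3) (fun _ : 'I_4 => 5%N)).
Proof.
move=> /nodal_normal_form [A uA ->]; split; first exact: three_sextactic.
split.
  move=> p Q Q' /(sextactic_root uA) [w [w3 sw]].
  move=> /(hyperosc_conicE uA w3 sw) [c [nc ->]] /(hyperosc_conicE uA w3 sw) [c' [nc' ->]].
  exists (c' / c); split; first by rewrite mulf_neq0 // invr_eq0.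
  by rewrite scalerA divfK.
split.
  move=> p Q /(sextactic_root uA) [w [w3 sw]] /(hyperosc_conicE uA w3 sw) [c [nc ->]].
  rewrite -scalerAr -rmorphM /= -lsub_scale_curve5 //; apply: free_curveZ => //.
  do 2![apply: free_curve_lsub; first by rewrite ?root_scale_unit ?(cube_neq0 w3)].
  exact: free_curve5.
split.
  move=> p1 p2 Q1 Q2 /(sextactic_root uA) [v [v3 sv]] /(sextactic_root uA) [w [w3 sw]].
  move=> /(root_neq uA sv sw) vw /(hyperosc_conicE uA v3 sv) [c [nc ->]].
  move=> /(hyperosc_conicE uA w3 sw) [d [nd ->]].
  have pull (P P1 P2 : S) : P * (c *: P1) * (d *: P2) = c *: (d *: (P * (P1 * P2))).
    by rewrite -!mul_mpolyC; ring.
  rewrite pull -!rmorphM /= -lsub_scale_curve7 //.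
  apply: free_curveZ => //; apply: free_curveZ => //.
  have u3 := third_root v3 w3 vw.
  do 2![apply: free_curve_lsub; first by rewrite ?root_scale_unit ?(cube_neq0 u3)].
  exact: free_curve7.
move=> p1 p2 p3 Q1 Q2 Q3 /(sextactic_root uA) [u [u3 su]].
move=> /(sextactic_root uA) [v [v3 sv]] /(sextactic_root uA) [w [w3 sw]].
move=> /(root_neq uA su sv) uv /(root_neq uA su sw) uw /(root_neq uA sv sw) vw.
move=> /(hyperosc_conicE uA u3 su) [c [nc ->]] /(hyperosc_conicE uA v3 sv) [d [nd ->]].
move=> /(hyperosc_conicE uA w3 sw) [e [ne ->]].
have pull (P P1 P2 P3 : S) : P * (c *: P1) * (d *: P2) * (e *: P3) =
    c *: (d *: (e *: (P * (P1 * (P2 * P3))))) by rewrite -!mul_mpolyC; ring.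
rewrite pull -!rmorphM /=.
rewrite -(curve9E u3 v3 w3 uv uw vw).
do 3![apply: msyzygy_curveZ => //].
by apply: msyzygy_curve_lsub => //; exact: msyzygy_curve9.
Qed.

End Assembly.

Theorem mainTheorem1 (R : realType) (F : {mpoly R[i][3]}) :
  irreducible_nodal_cubic F ->
  (* exactly three sextactic points *)
  (exists p : 'I_3 -> 'I_3 -> R[i],
      (forall k, sextactic_pt F (p k)) /\
      (forall k l, k != l -> ~ same_pt (p k) (p l)) /\
      (forall q, sextactic_pt F q -> exists k, same_pt (p k) q)) /\
  (* the hyperosculating conic at a sextactic point is unique *)
  (forall (p : 'I_3 -> R[i]) (Q Q' : {mpoly R[i][3]}),
      sextactic_pt F p -> hyperosculating_conic F Q p ->
      hyperosculating_conic F Q' p -> exists c : R[i], c != 0 /\ Q' = c *: Q) /\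
  (* (a) *)
  (forall (p : 'I_3 -> R[i]) (Q : {mpoly R[i][3]}),
      sextactic_pt F p -> hyperosculating_conic F Q p ->
      free_curve (F * Q) 2 2) /\
  (* (b) *)
  (forall (p1 p2 : 'I_3 -> R[i]) (Q1 Q2 : {mpoly R[i][3]}),
      sextactic_pt F p1 -> sextactic_pt F p2 -> ~ same_pt p1 p2 ->
      hyperosculating_conic F Q1 p1 -> hyperosculating_conic F Q2 p2 ->
      free_curve (F * Q1 * Q2) 3 3) /\
  (* (c) *)
  (forall (p1 p2 p3 : 'I_3 -> R[i]) (Q1 Q2 Q3 : {mpoly R[i][3]}),
      sextactic_pt F p1 -> sextactic_pt F p2 -> sextactic_pt F p3 ->
      ~ same_pt p1 p2 -> ~ same_pt p1 p3 -> ~ same_pt p2 p3 ->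
      hyperosculating_conic F Q1 p1 -> hyperosculating_conic F Q2 p2 ->
      hyperosculating_conic F Q3 p3 ->
      msyzygy_curve (F * Q1 * Q2 * Q3) (fun _ : 'I_4 => 5%N)).
Proof. exact: nodal_cubic_theorem. Qed.
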